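(* Let $\Gamma$ be a $C^2$, strictly convex, $\mathbb{D}_2$-symmetric billiard curve, and let $Z$ be one of its $\mathbb{D}_2$-symmetric $2$-periodic Birkhoff billiard orbits. Let $L=\|Z_{i+1}-Z_i\|$ and $\kappa=\kappa(Z_i)$; both are independent of $i$. Let $s\ge2$ be an integer and $p=2s$. If $\kappa L<2\cos^2(\pi/p)$, then $\Gamma$ admits a $\mathbb{D}_2$-symmetric non-Birkhoff periodic billiard orbit $z$ of minimal period $p$ and rotation number $\frac12$ which is of type II. That is: - $R(z_i)=z_{k-i}$ for all $i$, for some (unique) odd $k$ with $0<k<p$; - and either $S(z_i)=z_{p/2+i}$ for all $i$, or $(RS)(z_i)=z_{p/2+i}$ for all $i$. Moreover there are lifts $x$ of $z$ and $X$ of $Z$ in $\mathbb{X}_{p,s}$ such that $x-X$ changes sign exactly $2$ times per period $p$.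
   Context: $\mathbb{D}_2=\langle R,S\rangle$, where $R$ is rotation by $\pi$ and $S$ is the reflection in the horizontal axis. A billiard curve is a $C^2$ simple closed curve $\Gamma$ bounding a strictly convex domain. It is parametrized counterclockwise by a $1$-periodic $C^2$ immersion $\gamma$ descending to an embedding of $\mathbb{R}/\mathbb{Z}$, and chosen equivariant: $\gamma(x+1/2)=R\gamma(x)$, $\gamma(-x)=S\gamma(x)$. $\kappa$ denotes curvature. A billiard sequence is $z\in\Gamma^{\mathbb{Z}}$ with $z_i\ne z_{i+1}$. It is a billiard orbit if the billiard reflection law (angle of incidence equals angle of reflection with respect to the tangent) holds at every $z_i$. Lifts $x$ satisfy $\gamma(x_i)=z_i$ and $0<x_{i+1}-x_i<1$. $\mathbb{X}_{p,q}=\{x:x_{i+p}=x_i+q\}$. The rotation number is $\lim x_i/i$. A real sequence $x$ is Birkhoff if $x_i\le x_j+l\Rightarrow x_{i+m}\le x_{j+m}+l$ for all integers $i,j,l,m$. A billiard sequence is Birkhoff iff its lift is. $z$ is $G$-symmetric, for $G\subset\mathbb{D}_2$, if each $g\in G$ satisfies $g(z_i)=z_{k+i}$ for all $i$ or $g(z_i)=z_{k-i}$ for all $i$, for some $k=k(g)\in\mathbb{Z}$. *)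

(* Defs.v *)
From Stdlib Require Import Reals ZArith List.
From Coquelicot Require Import Coquelicot.
Open Scope R_scope.

Definition pt := (R * R)%type.
Definition vsub (a b : pt) : pt := (fst a - fst b, snd a - snd b).
Definition dot (a b : pt) : R := fst a * fst b + snd a * snd b.
Definition cross (a b : pt) : R := fst a * snd b - snd a * fst b.
Definition vnorm (a : pt) : R := sqrt (dot a a).

Definition rotR (a : pt) : pt := (- fst a, - snd a).
Definition reflS (a : pt) : pt := (fst a, - snd a).
Definition rotRS (a : pt) : pt := rotR (reflS a).

Definition dcurve (gamma : R -> pt) (t : R) : pt :=
  (Derive (fun u => fst (gamma u)) t, Derive (fun u => snd (gamma u)) t).
Definition ddcurve (gamma : R -> pt) (t : R) : pt := dcurve (dcurve gamma) t.

Definition C2_curve (gamma : R -> pt) : Prop :=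
  (forall t, ex_derive (fun u => fst (gamma u)) t /\ ex_derive (fun u => snd (gamma u)) t) /\
  (forall t, ex_derive (fun u => fst (dcurve gamma u)) t /\
             ex_derive (fun u => snd (dcurve gamma u)) t) /\
  (forall t, continuous (fun u => fst (ddcurve gamma u)) t /\
             continuous (fun u => snd (ddcurve gamma u)) t).

Definition curvature (gamma : R -> pt) (t : R) : R :=
  cross (dcurve gamma t) (ddcurve gamma t) / (vnorm (dcurve gamma t)) ^ 3.

(** Billiard curve: C^2, 1-periodic immersion descending to an embedding of R/Z,
    bounding a strictly convex domain and counterclockwise oriented (the domain
    lies strictly to the left of every oriented tangent line), D_2-equivariant. *)
Definition billiard_curve (gamma : R -> pt) : Prop :=
  C2_curve gamma /\
  (forall t, gamma (t + 1) = gamma t) /\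
  (forall t, dcurve gamma t <> (0, 0)) /\
  (forall s t, gamma s = gamma t -> exists n : Z, s - t = IZR n) /\
  (forall s t, gamma s <> gamma t ->
     cross (dcurve gamma t) (vsub (gamma s) (gamma t)) > 0) /\
  (forall t, gamma (t + 1/2) = rotR (gamma t)) /\
  (forall t, gamma (- t) = reflS (gamma t)).

Definition on_curve (gamma : R -> pt) (z : Z -> pt) : Prop :=
  forall i, exists t, gamma t = z i.

Definition billiard_sequence (gamma : R -> pt) (z : Z -> pt) : Prop :=
  on_curve gamma z /\ forall i, z i <> z (i + 1)%Z.

(** Reflection law at z_i: the incoming and outgoing unit directions make
    equal angles with the tangent (equal tangential components). *)
Definition reflection_law (gamma : R -> pt) (z : Z -> pt) (i : Z) : Prop :=
  exists t, gamma t = z i /\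
    dot (vsub (z (i + 1)%Z) (z i)) (dcurve gamma t) / vnorm (vsub (z (i + 1)%Z) (z i))
    = dot (vsub (z i) (z (i - 1)%Z)) (dcurve gamma t) / vnorm (vsub (z i) (z (i - 1)%Z)).

Definition billiard_orbit (gamma : R -> pt) (z : Z -> pt) : Prop :=
  billiard_sequence gamma z /\ forall i, reflection_law gamma z i.

Definition is_lift (gamma : R -> pt) (z : Z -> pt) (x : Z -> R) : Prop :=
  forall i, gamma (x i) = z i /\ 0 < x (i + 1)%Z - x i < 1.

Definition in_X (p q : Z) (x : Z -> R) : Prop :=
  forall i, x (i + p)%Z = x i + IZR q.

Definition birkhoff_seq (x : Z -> R) : Prop :=
  forall i j l m : Z, x i <= x j + IZR l -> x (i + m)%Z <= x (j + m)%Z + IZR l.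

Definition birkhoff (gamma : R -> pt) (z : Z -> pt) : Prop :=
  exists x, is_lift gamma z x /\ birkhoff_seq x.

Definition has_rotation_number (gamma : R -> pt) (z : Z -> pt) (rho : R) : Prop :=
  exists x, is_lift gamma z x /\
    is_lim_seq (fun n : nat => x (Z.of_nat n) / INR n) (Finite rho).

Definition periodic (z : Z -> pt) (p : Z) : Prop := forall i, z (i + p)%Z = z i.
Definition minimal_period (z : Z -> pt) (p : Z) : Prop :=
  (0 < p)%Z /\ periodic z p /\ forall q, (0 < q < p)%Z -> ~ periodic z q.

Definition g_symmetric (g : pt -> pt) (z : Z -> pt) : Prop :=
  exists k : Z, (forall i, g (z i) = z (k + i)%Z) \/ (forall i, g (z i) = z (k - i)%Z).

Definition D2_symmetric (z : Z -> pt) : Prop :=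
  g_symmetric (fun a => a) z /\ g_symmetric rotR z /\ g_symmetric reflS z /\
  g_symmetric rotRS z.

(** Sign changes of a p-periodic real sequence d, counted cyclically after
    discarding zero terms: index i (0 <= i < p) contributes a sign change
    when d_i <> 0 and the next nonzero term after i has the opposite sign. *)
Definition sign_change_at (d : Z -> R) (p i : Z) : Prop :=
  d i <> 0 /\
  exists j, (i < j <= i + p)%Z /\ d j * d i < 0 /\
            forall k, (i < k < j)%Z -> d k = 0.

Definition num_sign_changes_eq (d : Z -> R) (p : Z) (n : nat) : Prop :=
  exists l : list Z, NoDup l /\
    (forall i, In i l <-> ((0 <= i < p)%Z /\ sign_change_at d p i)) /\
    length l = n.

(* Main.v *)
Require Import Defs.
From Stdlib Require Import Reals ZArith List Lra Lia ClassicalEpsilon FunctionalExtensionality.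
From Coquelicot Require Import Coquelicot.
Open Scope R_scope.

(** Let [Zo] have lift [c + i/2] and look for an orbit with lift [c + i/2 + U i]. After the
central symmetry the chord between consecutive points has length [h a b = |G a + G b|], where
[a = U i], [b = U (i+1)] and [G t = gamma (c + t)], so [U] gives an orbit as soon as it is
critical for the sum of the [h (U i) (U (i+1))]. Imposing [U (-1-i) = U i] and [U (i+s) = - U
i] leaves the [s/2] free values over a quarter period. Maximise the length over [[0, 1/4]] in
each of them. If some value is [0], the gradient forces its neighbours, hence all values, to be
[0]; but [U = 0] is not a maximum, since the curvature condition makes the second variation
positive along [cos (PI (2i+1) / (2s))]. If some value is [1/4], then so are all the following
ones, which contradicts the antisymmetry at the end of the quarter. So the maximiser is
interior, hence critical, and positive on the quarter period: [U] changes sign exactly twice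
per period. A Birkhoff lift would make [U] monotone along steps of 2, which is incompatible
with [U (i+s) = - U i] and [U (-1) = U 0]. *)

(** * Maximising a chain of pair interactions *)

Definition upd (w : nat -> R) (i : nat) (t : R) (k : nat) : R :=
  if Nat.eqb k i then t else w k.

(** The left boundary term [e] is a parameter, so that the first variable can be eliminated by
    absorbing it into a new [e]. *)
Fixpoint chain (e : R -> R) (h : R -> R -> R) (n : nat) (w : nat -> R) : R :=
  match n with
  | O => e (w O)
  | S k => chain e h k w + h (w k) (w (S k))
  end.

Lemma chain_peel (e : R -> R) (h : R -> R -> R) (n : nat) (w : nat -> R) :
  chain e h (S n) w = chain (fun b => e (w O) + h (w O) b) h n (fun k => w (S k)).
Proof.
induction n as [|n IH]; [reflexivity|].
change (chain e h (S (S n)) w) with (chain e h (S n) w + h (w (S n)) (w (S (S n)))).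
rewrite IH; reflexivity.
Qed.

Lemma chain_le (e e' : R -> R) (h : R -> R -> R) (n : nat) (w : nat -> R) :
  e (w O) <= e' (w O) -> chain e h n w <= chain e' h n w.
Proof. intros H; induction n as [|n IH]; simpl; lra. Qed.

Lemma chain_ext (e : R -> R) (h : R -> R -> R) (n : nat) (w w' : nat -> R) :
  (forall k, (k <= n)%nat -> w k = w' k) -> chain e h n w = chain e h n w'.
Proof.
induction n as [|n IH]; intros H; simpl.
- now rewrite H.
- rewrite IH by (intros; apply H; lia). now rewrite !H by lia.
Qed.

(** One step of dynamic programming. The maximiser [v] is merely chosen and may jump, but the value
    function is continuous, because [h] varies uniformly little in [y] over all [x] in the
    interval. *)
Lemma partial_max_continuous (a b : R) (e : R -> R) (h : R -> R -> R) :
  a <= b ->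
  (forall x, a <= x <= b -> continuity_pt e x) ->
  (forall x y, continuity_2d_pt h x y) ->
  exists v : R -> R,
    (forall y, a <= v y <= b) /\
    (forall x y, a <= x <= b -> e x + h x y <= e (v y) + h (v y) y) /\
    (forall y, a <= y <= b -> continuity_pt (fun y => e (v y) + h (v y) y) y).
Proof.
intros Hab He Hh.
assert (Hmax : forall y, exists x, (forall c, a <= c <= b -> e c + h c y <= e x + h x y) /\ a <= x <= b).
{ intros y. apply (continuity_ab_maj (fun x => e x + h x y) a b Hab).
  intros c Hc. apply (continuity_pt_plus e (fun x => h x y)); [now apply He|].
  apply continuity_pt_locally. intros eps.
  destruct (Hh c y eps) as [d Hd]. exists d. intros u Hu. apply Hd; [exact Hu|].
  rewrite Rminus_diag, Rabs_R0. apply d. }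
set (v := fun y => proj1_sig (constructive_indefinite_description _ (Hmax y))).
assert (Hv : forall y, (forall c, a <= c <= b -> e c + h c y <= e (v y) + h (v y) y) /\ a <= v y <= b).
{ intros y. exact (proj2_sig (constructive_indefinite_description _ (Hmax y))). }
exists v. split; [apply Hv|]. split; [intros x y Hx; now apply Hv|].
intros y Hy. apply continuity_pt_locally. intros eps.
(* The second side is widened by 1 since a point [u] near [y] may leave the interval; capping the
   radius at 1 keeps it in this rectangle. *)
destruct (uniform_continuity_2d h a b (a - 1) (b + 1) (fun x y _ _ => Hh x y) eps) as [d Hd].
assert (Hd1 : 0 < Rmin d 1) by (apply Rmin_glb_lt; [apply d|lra]).
exists (mkposreal _ Hd1). intros u Hu.
assert (Hu' : Rabs (u - y) < Rmin d 1) by exact Hu.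
assert (Hud : Rabs (u - y) < d) by (eapply Rlt_le_trans; [exact Hu'|apply Rmin_l]).
assert (Hu1 : Rabs (u - y) < 1) by (eapply Rlt_le_trans; [exact Hu'|apply Rmin_r]).
apply Rabs_def2 in Hu1.
assert (Hclose : forall x, a <= x <= b -> Rabs (h x u - h x y) < eps).
{ intros x Hx. apply Hd; try lra. rewrite Rminus_diag, Rabs_R0; apply d. }
destruct (Hv y) as [Hy1 Hy2]. destruct (Hv u) as [Hu3 Hu4].
specialize (Hy1 _ Hu4). specialize (Hu3 _ Hy2).
pose proof (Rabs_def2 _ _ (Hclose _ Hy2)). pose proof (Rabs_def2 _ _ (Hclose _ Hu4)).
apply Rabs_def1; lra.
Qed.

(** Existence of a maximiser on a box by eliminating one variable at a time. The boundary term
    changes at each step, hence the quantification over [e] inside the induction. *)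
Lemma chain_max (a b : R) (h : R -> R -> R) (r : R -> R) :
  a <= b ->
  (forall x y, continuity_2d_pt h x y) ->
  (forall x, a <= x <= b -> continuity_pt r x) ->
  forall (n : nat) (e : R -> R),
  (forall x, a <= x <= b -> continuity_pt e x) ->
  exists u : nat -> R, (forall i, a <= u i <= b) /\
    forall w : nat -> R, (forall i, a <= w i <= b) ->
      chain e h n w + r (w n) <= chain e h n u + r (u n).
Proof.
intros Hab Hh Hr n. induction n as [|n IH]; intros e He.
- destruct (continuity_ab_maj (fun x => e x + r x) a b Hab) as [x [Hx Hxab]].
  { intros c Hc. apply (continuity_pt_plus e r); auto. }
  exists (fun _ => x). split; [auto|]. intros w Hw. apply Hx, Hw.
- destruct (partial_max_continuous a b e h Hab He Hh) as [v [Hv1 [Hv2 Hv3]]].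
  destruct (IH _ Hv3) as [u [Hu1 Hu2]].
  (* The eliminated first value is recovered as the best response [v] to its neighbour. *)
  exists (fun i => match i with O => v (u O) | S k => u k end). split.
  + intros [|i]; auto.
  + intros w Hw.
    specialize (Hu2 (fun k => w (S k)) (fun k => Hw (S k))).
    rewrite !chain_peel.
    set (e' := fun y => e (v y) + h (v y) y) in Hu2.
    assert (H1 := chain_le (fun y => e (w O) + h (w O) y) e' h n (fun k => w (S k))
                   (Hv2 (w O) (w 1%nat) (Hw O))).
    assert (H2 := chain_le e' (fun y => e (v (u O)) + h (v (u O)) y) h n u (Rle_refl _)).
    change (fun k : nat => u k) with u.
    cbv beta in *. lra.
Qed.

Definition left_bond (e : R -> R) (h : R -> R -> R) (w : nat -> R) (i : nat) (t : R) : R :=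
  match i with O => e t | S k => h (w k) t end.

Definition right_bond (h : R -> R -> R) (r : R -> R) (n : nat) (w : nat -> R) (i : nat) (t : R) : R :=
  if Nat.eqb i n then r t else h t (w (S i)).

Lemma upd_same (w : nat -> R) (i : nat) (t : R) : upd w i t i = t.
Proof. unfold upd. now rewrite Nat.eqb_refl. Qed.

Lemma upd_other (w : nat -> R) (i k : nat) (t : R) : k <> i -> upd w i t k = w k.
Proof. unfold upd. intros H. now rewrite (proj2 (Nat.eqb_neq k i) H). Qed.

Lemma chain_upd_last (e : R -> R) (h : R -> R -> R) (w : nat -> R) (n : nat) (t : R) :
  chain e h n (upd w n t) - chain e h n w = left_bond e h w n t - left_bond e h w n (w n).
Proof.
destruct n as [|n]; simpl.
- now rewrite upd_same.
- rewrite (chain_ext e h n (upd w (S n) t) w) by (intros k Hk; apply upd_other; lia).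
  rewrite upd_same, upd_other by lia. ring.
Qed.

(** Moving one value affects only its two bonds, so a maximiser of the whole chain maximises a
    one-variable function at each index. *)
Lemma chain_upd (e : R -> R) (h : R -> R -> R) (r : R -> R) (w : nat -> R) (n i : nat) (t : R) :
  (i <= n)%nat ->
  (chain e h n (upd w i t) + r (upd w i t n)) - (chain e h n w + r (w n)) =
  (left_bond e h w i t + right_bond h r n w i t)
  - (left_bond e h w i (w i) + right_bond h r n w i (w i)).
Proof.
intros Hi. unfold right_bond. destruct (Nat.eqb_spec i n) as [->|Hne].
- rewrite upd_same. pose proof (chain_upd_last e h w n t). lra.
- rewrite (upd_other w i n) by lia.
  enough (chain e h n (upd w i t) - chain e h n w =
          left_bond e h w i t + h t (w (S i)) - (left_bond e h w i (w i) + h (w i) (w (S i)))) by lra.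
  assert (Hlt : (i < n)%nat) by lia. clear Hi Hne.
  induction n as [|n IH]; [lia|]. simpl.
  rewrite (upd_other w i (S n)) by lia.
  destruct (Nat.eq_dec i n) as [->|Hne].
  + rewrite upd_same. pose proof (chain_upd_last e h w n t). lra.
  + rewrite upd_other by lia. specialize (IH ltac:(lia)). lra.
Qed.

(** One-sided first-order conditions: each endpoint of the interval invalidates one of them, and in
    the interior both hold and give [d = 0]. *)
Lemma derive_at_max (phi : R -> R) (a b x d : R) :
  a < b -> a <= x <= b ->
  (forall t, a <= t <= b -> phi t <= phi x) -> is_derive phi x d ->
  (x < b -> d <= 0) /\ (a < x -> 0 <= d).
Proof.
intros Hab Hx Hmax Hd. apply is_derive_Reals in Hd. split; intros Hlt.
- destruct (Rle_dec d 0) as [|Hn]; [assumption|exfalso].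
  destruct (Hd (d/2) ltac:(lra)) as [del Hdel].
  set (k := Rmin (del/2) (b - x)).
  assert (Hk : 0 < k) by (apply Rmin_glb_lt; [pose proof (cond_pos del); lra|lra]).
  assert (k <= del/2) by apply Rmin_l. assert (k <= b - x) by apply Rmin_r.
  specialize (Hdel k ltac:(lra)).
  rewrite Rabs_pos_eq in Hdel by lra. specialize (Hdel ltac:(pose proof (cond_pos del); lra)).
  specialize (Hmax (x + k) ltac:(lra)).
  apply Rabs_def2 in Hdel. destruct Hdel as [_ Hdel].
  assert ((phi (x + k) - phi x) / k <= 0).
  { apply Rmult_le_reg_r with k; [lra|]. unfold Rdiv. rewrite Rmult_assoc, Rinv_l by lra. lra. }
  lra.
- destruct (Rle_dec 0 d) as [|Hn]; [assumption|exfalso].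
  destruct (Hd (-d/2) ltac:(lra)) as [del Hdel].
  set (k := Rmin (del/2) (x - a)).
  assert (Hk : 0 < k) by (apply Rmin_glb_lt; [pose proof (cond_pos del); lra|lra]).
  assert (k <= del/2) by apply Rmin_l. assert (k <= x - a) by apply Rmin_r.
  specialize (Hdel (-k) ltac:(lra)).
  rewrite Rabs_Ropp, Rabs_pos_eq in Hdel by lra. specialize (Hdel ltac:(pose proof (cond_pos del); lra)).
  specialize (Hmax (x + -k) ltac:(lra)).
  apply Rabs_def2 in Hdel. destruct Hdel as [Hdel _].
  assert (0 <= (phi (x + -k) - phi x) / -k).
  { apply Rmult_le_reg_r with k; [lra|]. replace ((phi (x + -k) - phi x) / -k * k) with (phi x - phi (x + -k)) by (field; lra). lra. }
  lra.
Qed.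

(** * The billiard table in coordinates adapted to the 2-periodic orbit *)

(* [(f, g)] are the coordinates of the curve along and across the axis that carries the 2-periodic orbit, which sits at parameters [0] and [1/2]. *)
Record oval_frame (f g df dg : R -> R) : Prop := {
  of_df : forall t, is_derive f t (df t);
  of_dg : forall t, is_derive g t (dg t);
  of_even : forall t, f (- t) = f t;
  of_odd : forall t, g (- t) = - g t;
  of_fhalf : forall t, f (t + 1/2) = - f t;
  of_ghalf : forall t, g (t + 1/2) = - g t;
  of_f0 : 0 < f 0;
  of_convex : forall s t, (forall n : Z, s - t <> IZR n) ->
    0 < df t * (g s - g t) - dg t * (f s - f t)
}.

Definition chord (f g : R -> R) (a b : R) : R :=
  sqrt ((f a + f b) * (f a + f b) + (g a + g b) * (g a + g b)).

(** The partial derivative of [chord] in its first argument, wherever the chord is nonzero. *)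
Definition force (f g df dg : R -> R) (a b : R) : R :=
  (df a * (f a + f b) + dg a * (g a + g b)) / chord f g a b.

Lemma not_integer_between (x : R) (k : Z) : IZR k < x < IZR k + 1 -> forall n : Z, x <> IZR n.
Proof.
intros Hx n ->. rewrite <- plus_IZR in Hx. destruct Hx as [H1 H2].
apply lt_IZR in H1. apply lt_IZR in H2. lia.
Qed.

Lemma derive_of_symmetric (f df : R -> R) (c sg : R) :
  (forall t, is_derive f t (df t)) -> (forall t, f (c - t) = sg * f t) ->
  forall t, df (c - t) = - (sg * df t).
Proof.
intros Hd Hs t.
assert (H1 : is_derive (fun u => f (c - u)) t (- df (c - t))).
{ evar (l : R). replace (- df (c - t)) with l; [unfold l; apply is_derive_Reals|].
  apply (derivable_pt_lim_comp (fun u => c - u) f).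
  apply derivable_pt_lim_minus; [apply derivable_pt_lim_const|apply derivable_pt_lim_id].
  apply is_derive_Reals, Hd. unfold l. ring. }
assert (H2 : is_derive (fun u => f (c - u)) t (sg * df t)).
{ apply is_derive_ext with (fun u => sg * f u); [intros; now rewrite Hs|].
  apply (is_derive_scal f t sg (df t)), Hd. }
apply is_derive_unique in H1. apply is_derive_unique in H2. rewrite H1 in H2. lra.
Qed.

Lemma positive_derivative_lt (f df : R -> R) (a b : R) :
  (forall t, is_derive f t (df t)) -> (forall t, a <= t <= b -> 0 < df t) -> a < b -> f a < f b.
Proof.
intros Hd Hp Hab.
destruct (MVT_gen f a b df) as [c [Hc Heq]].
- intros; apply Hd.
- intros x _. apply derivable_continuous_pt. exists (df x). apply is_derive_Reals, Hd.
- rewrite Rmin_left, Rmax_right in Hc by lra. specialize (Hp c Hc). nra.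
Qed.

Lemma is_derive_norm2 (x y : R -> R) (t dx dy : R) :
  is_derive x t dx -> is_derive y t dy -> 0 < x t * x t + y t * y t ->
  is_derive (fun u => sqrt (x u * x u + y u * y u)) t
    ((dx * x t + dy * y t) / sqrt (x t * x t + y t * y t)).
Proof.
intros Hx Hy Hp.
pose proof (sqrt_lt_R0 _ Hp).
pose proof (is_derive_unique _ _ _ Hx) as E1. pose proof (is_derive_unique _ _ _ Hy) as E2.
assert (X1 : ex_derive x t) by (eexists; exact Hx).
assert (X2 : ex_derive y t) by (eexists; exact Hy).
auto_derive.
- tauto.
- change (fun u => x u) with x. change (fun u => y u) with y. rewrite E1, E2. field. lra.
Qed.

Section Frame.

Variables f g df dg : R -> R.
Hypothesis Hfr : oval_frame f g df dg.

Let h := chord f g.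
Let D := force f g df dg.

Lemma frame_f_quarter t : f (1/2 - t) = - f t.
Proof. replace (1/2 - t) with (- t + 1/2) by ring. now rewrite (of_fhalf _ _ _ _ Hfr), (of_even _ _ _ _ Hfr). Qed.

Lemma frame_g_quarter t : g (1/2 - t) = g t.
Proof. replace (1/2 - t) with (- t + 1/2) by ring. rewrite (of_ghalf _ _ _ _ Hfr), (of_odd _ _ _ _ Hfr). ring. Qed.

Lemma frame_g0 : g 0 = 0.
Proof. pose proof (of_odd _ _ _ _ Hfr 0) as H. rewrite Ropp_0 in H. lra. Qed.

Lemma frame_f14 : f (1/4) = 0.
Proof. pose proof (frame_f_quarter (1/4)) as H. replace (1/2 - 1/4) with (1/4) in H by field. lra. Qed.

Lemma frame_df_odd t : df (- t) = - df t.
Proof.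
replace (- t) with (0 - t) by ring.
rewrite (derive_of_symmetric f df 0 1 (of_df _ _ _ _ Hfr)); [ring|].
intros u. replace (0 - u) with (- u) by ring. rewrite (of_even _ _ _ _ Hfr). ring.
Qed.

Lemma frame_dg_even t : dg (- t) = dg t.
Proof.
replace (- t) with (0 - t) by ring.
rewrite (derive_of_symmetric g dg 0 (-1) (of_dg _ _ _ _ Hfr)); [ring|].
intros u. replace (0 - u) with (- u) by ring. rewrite (of_odd _ _ _ _ Hfr). ring.
Qed.

Lemma frame_df0 : df 0 = 0.
Proof. pose proof (frame_df_odd 0) as H. rewrite Ropp_0 in H. lra. Qed.

Lemma frame_dg14 : dg (1/4) = 0.
Proof.
pose proof (derive_of_symmetric g dg (1/2) 1 (of_dg _ _ _ _ Hfr)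
  ltac:(intros u; rewrite frame_g_quarter; ring) (1/4)) as H.
replace (1/2 - 1/4) with (1/4) in H by field. lra.
Qed.

Lemma frame_f_continuous t : continuity_pt f t.
Proof. apply derivable_continuous_pt. exists (df t). apply is_derive_Reals, (of_df _ _ _ _ Hfr). Qed.

Lemma frame_g_continuous t : continuity_pt g t.
Proof. apply derivable_continuous_pt. exists (dg t). apply is_derive_Reals, (of_dg _ _ _ _ Hfr). Qed.

(* Convexity applied to the pair of points symmetric about the transverse axis. *)
Lemma frame_dg_f t : - (1/4) < t < 1/4 -> 0 < dg t * f t.
Proof.
intros Ht. pose proof (of_convex _ _ _ _ Hfr (1/2 - t) t) as H.
rewrite frame_f_quarter, frame_g_quarter in H.
enough (0 < df t * (g t - g t) - dg t * (- f t - f t)) by lra.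
apply H. apply (not_integer_between _ 0). lra.
Qed.

(** Convexity applied to [t] and [- t], which are symmetric about the axis carrying the 2-periodic
    orbit. *)
Lemma frame_df_g t : 0 < t < 1/2 -> df t * g t < 0.
Proof.
intros Ht. pose proof (of_convex _ _ _ _ Hfr (- t) t) as H.
rewrite (of_even _ _ _ _ Hfr), (of_odd _ _ _ _ Hfr) in H.
enough (0 < df t * (- g t - g t) - dg t * (f t - f t)) by lra.
apply H. apply (not_integer_between _ (-1)). lra.
Qed.

(** By [frame_dg_f] the function [f] has no zero in the open interval, so its sign at [0]
    persists. *)
Lemma frame_f_pos t : - (1/4) < t < 1/4 -> 0 < f t.
Proof.
assert (Hpos : forall t, 0 <= t < 1/4 -> 0 < f t).
{ intros u Hu. destruct (Rlt_dec 0 (f u)) as [|Hn]; [assumption|exfalso].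
  pose proof (of_f0 _ _ _ _ Hfr) as H0.
  destruct (IVT_gen f 0 u 0) as [x [Hx Hfx]].
  - intros y. apply frame_f_continuous.
  - rewrite Rmin_right, Rmax_left by lra. lra.
  - rewrite Rmin_left, Rmax_right in Hx by lra.
    pose proof (frame_dg_f x ltac:(lra)) as H. rewrite Hfx in H. lra. }
intros Ht. destruct (Rle_dec 0 t) as [H|H].
- apply Hpos; lra.
- rewrite <- (of_even _ _ _ _ Hfr). apply Hpos; lra.
Qed.

Lemma frame_dg_pos t : - (1/4) < t < 1/4 -> 0 < dg t.
Proof. intros Ht. pose proof (frame_dg_f t Ht). pose proof (frame_f_pos t Ht). nra. Qed.

Lemma frame_g_pos t : 0 < t <= 1/4 -> 0 < g t.
Proof.
intros Ht.
assert (Hlt : forall u, 0 < u < 1/4 -> 0 < g u).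
{ intros u Hu. rewrite <- frame_g0. apply (positive_derivative_lt g dg).
  - apply (of_dg _ _ _ _ Hfr).
  - intros x Hx. apply frame_dg_pos. lra.
  - lra. }
destruct (Req_dec t (1/4)) as [->|Hne]; [|apply Hlt; lra].
(* Since [dg] vanishes at [1/4], the endpoint is reached by weak monotonicity from [1/8], where [g]
   is already positive. *)
destruct (MVT_gen g (1/8) (1/4) dg) as [c [Hc Heq]].
- intros; apply (of_dg _ _ _ _ Hfr).
- intros; apply frame_g_continuous.
- rewrite Rmin_left, Rmax_right in Hc by lra.
  assert (0 <= dg c).
  { destruct (Req_dec c (1/4)) as [->|]; [rewrite frame_dg14; lra|].
    apply Rlt_le, frame_dg_pos; lra. }
  pose proof (Hlt (1/8) ltac:(lra)). nra.
Qed.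

Lemma frame_df_neg t : 0 < t <= 1/4 -> df t < 0.
Proof. intros Ht. pose proof (frame_df_g t ltac:(lra)). pose proof (frame_g_pos t Ht). nra. Qed.

Lemma frame_f_nonneg t : 0 <= t <= 1/4 -> 0 <= f t.
Proof.
intros Ht. destruct (Req_dec t (1/4)) as [->|]; [rewrite frame_f14; lra|].
apply Rlt_le, frame_f_pos; lra.
Qed.

Lemma frame_g_nonneg t : 0 <= t <= 1/4 -> 0 <= g t.
Proof.
intros Ht. destruct (Req_dec t 0) as [->|]; [rewrite frame_g0; lra|].
apply Rlt_le, frame_g_pos; lra.
Qed.

Lemma frame_f_le t : 0 <= t <= 1/4 -> f t <= f 0.
Proof.
intros Ht.
destruct (MVT_gen f 0 t df) as [c [Hc Heq]].
- intros; apply (of_df _ _ _ _ Hfr).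
- intros; apply frame_f_continuous.
- rewrite Rmin_left, Rmax_right in Hc by lra.
  assert (df c <= 0).
  { destruct (Req_dec c 0) as [->|]; [rewrite frame_df0; lra|]. apply Rlt_le, frame_df_neg; lra. }
  nra.
Qed.

(** * Chord length and its derivatives *)

Lemma chord_sym a b : h a b = h b a.
Proof. unfold h, chord. now rewrite (Rplus_comm (f a)), (Rplus_comm (g a)). Qed.

Lemma chord_pos_of_f a b : 0 < f a + f b -> 0 < h a b.
Proof.
intros H. apply sqrt_lt_R0. pose proof (Rle_0_sqr (g a + g b)) as Hsq. unfold Rsqr in Hsq.
pose proof (Rmult_lt_0_compat _ _ H H). lra.
Qed.

Lemma chord_pos a b : 0 <= a <= 1/4 -> 0 <= b <= 1/4 -> 0 < h a b.
Proof.
intros Ha Hb. pose proof (frame_f_nonneg a Ha). pose proof (frame_f_nonneg b Hb).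
pose proof (frame_g_nonneg a Ha). pose proof (frame_g_nonneg b Hb).
destruct (Req_dec a 0) as [->|].
- pose proof (of_f0 _ _ _ _ Hfr). apply chord_pos_of_f. lra.
- pose proof (frame_g_pos a ltac:(lra)). assert (Hs : 0 < g a + g b) by lra.
  apply sqrt_lt_R0. pose proof (Rle_0_sqr (f a + f b)) as Hsq. unfold Rsqr in Hsq.
  pose proof (Rmult_lt_0_compat _ _ Hs Hs). lra.
Qed.

Lemma chord_continuous a b : continuity_2d_pt h a b.
Proof.
assert (Hc : forall k, (forall t, continuity_pt k t) -> continuity_2d_pt (fun x y => k x + k y) a b).
{ intros k Hk. apply continuity_2d_pt_plus.
  - apply continuity_1d_2d_pt_comp; [apply Hk|apply continuity_2d_pt_id1].
  - apply continuity_1d_2d_pt_comp; [apply Hk|apply continuity_2d_pt_id2]. }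
apply (continuity_1d_2d_pt_comp sqrt).
- apply continuity_pt_sqrt.
  pose proof (Rle_0_sqr (f a + f b)). pose proof (Rle_0_sqr (g a + g b)). unfold Rsqr in *. lra.
- apply continuity_2d_pt_plus; apply continuity_2d_pt_mult; apply Hc;
    intros; (apply frame_f_continuous || apply frame_g_continuous).
Qed.

Lemma chord_pos_inv a b : 0 < h a b -> 0 < (f a + f b) * (f a + f b) + (g a + g b) * (g a + g b).
Proof.
intros Hp. apply Rnot_le_lt. intros Hn. unfold h, chord in Hp.
rewrite sqrt_neg_0 in Hp by exact Hn. lra.
Qed.

Lemma is_derive_chord a b : 0 < h a b -> is_derive (fun t => h t b) a (D a b).
Proof.
intros Hp.
apply (is_derive_norm2 (fun t => f t + f b) (fun t => g t + g b)); [| |now apply chord_pos_inv].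
- replace (df a) with (df a + 0) by ring.
  apply (is_derive_plus f (fun _ => f b)); [apply (of_df _ _ _ _ Hfr)|apply (is_derive_const (f b))].
- replace (dg a) with (dg a + 0) by ring.
  apply (is_derive_plus g (fun _ => g b)); [apply (of_dg _ _ _ _ Hfr)|apply (is_derive_const (g b))].
Qed.

Lemma is_derive_chord_r a b : 0 < h a b -> is_derive (fun t => h b t) a (D a b).
Proof.
intros Hp. apply is_derive_ext with (fun t => h t b); [intros; apply chord_sym|].
now apply is_derive_chord.
Qed.

(** The reversal symmetry gives indices [-1] and [0] the same value. Half of the bond between them
    is the left boundary term, and the factor 1/2 makes its derivative the force on one end. *)
Lemma is_derive_chord_diag a : 0 < h a a -> is_derive (fun t => h t t / 2) a (D a a).
Proof.
intros Hp.
replace (D a a) with (/ 2 * (2 * D a a)) by field.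
apply is_derive_ext with (fun t => / 2 * h t t); [intros; unfold Rdiv; apply Rmult_comm|].
apply (is_derive_scal (fun t => h t t) a (/ 2)).
replace (2 * D a a) with (((df a + df a) * (f a + f a) + (dg a + dg a) * (g a + g a)) / h a a)
  by (unfold D, force; fold h; field; lra).
apply (is_derive_norm2 (fun t => f t + f t) (fun t => g t + g t)); [| |now apply chord_pos_inv].
- apply (is_derive_plus f f); apply (of_df _ _ _ _ Hfr).
- apply (is_derive_plus g g); apply (of_dg _ _ _ _ Hfr).
Qed.

Lemma chord_opp a b : h (- a) (- b) = h a b.
Proof.
unfold h, chord. rewrite !(of_even _ _ _ _ Hfr), !(of_odd _ _ _ _ Hfr).
f_equal. ring.
Qed.

Lemma force_opp a b : D (- a) (- b) = - D a b.
Proof.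
unfold D, force. fold h. rewrite chord_opp, !(of_even _ _ _ _ Hfr), !(of_odd _ _ _ _ Hfr), frame_df_odd, frame_dg_even.
unfold Rdiv. ring.
Qed.

(** For even [s] the last bond of the quarter joins [a] to [- a] and has length [2 * f a]; its half,
    [f], serves as right boundary term, with derivative the force on one end. *)
Lemma force_antidiag a : 0 < f a -> D a (- a) = df a.
Proof.
intros Ha. unfold D, force, chord. rewrite (of_even _ _ _ _ Hfr), (of_odd _ _ _ _ Hfr).
replace ((f a + f a) * (f a + f a) + (g a + - g a) * (g a + - g a)) with ((2 * f a) * (2 * f a)) by ring.
rewrite sqrt_square by lra. field. lra.
Qed.

Lemma force_zero_eq b : 0 <= b <= 1/4 -> D 0 b = dg 0 / h 0 b * g b.
Proof. intros Hb. unfold D, force. fold h. rewrite frame_df0, frame_g0. unfold Rdiv. ring. Qed.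

Lemma force_zero_nonneg b : 0 <= b <= 1/4 -> 0 <= D 0 b.
Proof.
intros Hb. rewrite force_zero_eq by assumption.
apply Rmult_le_pos; [|now apply frame_g_nonneg].
apply Rlt_le, Rdiv_lt_0_compat; [apply frame_dg_pos; lra|apply chord_pos; lra].
Qed.

(** A positive neighbour pushes a value at [0] into the box; this is what makes a zero of a
    maximiser spread. *)
Lemma force_zero_pos b : 0 < b <= 1/4 -> 0 < D 0 b.
Proof.
intros Hb. rewrite force_zero_eq by lra.
apply Rmult_lt_0_compat; [|now apply frame_g_pos].
apply Rdiv_lt_0_compat; [apply frame_dg_pos; lra|apply chord_pos; lra].
Qed.

Lemma force_quarter_eq b : 0 <= b <= 1/4 -> D (1/4) b = df (1/4) / h (1/4) b * f b.
Proof. intros Hb. unfold D, force. fold h. rewrite frame_dg14, frame_f14. unfold Rdiv. ring. Qed.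

Lemma force_quarter_nonpos b : 0 <= b <= 1/4 -> D (1/4) b <= 0.
Proof.
intros Hb. rewrite force_quarter_eq by assumption.
pose proof (frame_f_nonneg b Hb). pose proof (frame_df_neg (1/4) ltac:(lra)).
assert (0 < - df (1/4) / h (1/4) b) by (apply Rdiv_lt_0_compat; [lra|apply chord_pos; lra]).
unfold Rdiv in *. nra.
Qed.

(** The counterpart at the upper face: a neighbour below [1/4] pulls a value at [1/4] back into the
    box. *)
Lemma force_quarter_neg b : 0 <= b < 1/4 -> D (1/4) b < 0.
Proof.
intros Hb. rewrite force_quarter_eq by lra.
pose proof (frame_f_pos b ltac:(lra)). pose proof (frame_df_neg (1/4) ltac:(lra)).
assert (0 < - df (1/4) / h (1/4) b) by (apply Rdiv_lt_0_compat; [lra|apply chord_pos; lra]).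
unfold Rdiv in *. nra.
Qed.

(** * Quadratic lower bounds near the 2-periodic orbit *)

Lemma frame_f_lower (d2 A : R) :
  is_derive df 0 d2 -> - d2 / 2 < A ->
  exists t0, 0 < t0 /\ forall t, 0 <= t <= t0 -> f 0 - A * t ^ 2 <= f t.
Proof.
intros Hd HA. apply is_derive_Reals in Hd.
(* This tolerance keeps the difference quotient of [df] at [0] above [- 2 * A], so that
   [f u + A * u ^ 2] has nonnegative derivative to the right of [0]. *)
destruct (Hd (2 * A + d2) ltac:(lra)) as [del Hdel].
exists (del / 2). split; [pose proof (cond_pos del); lra|].
intros t Ht.
destruct (MVT_gen (fun u => f u + A * u ^ 2) 0 t (fun u => df u + 2 * A * u)) as [c [Hc Heq]].
- intros u _. apply (is_derive_plus f (fun u => A * u ^ 2)); [apply (of_df _ _ _ _ Hfr)|].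
  auto_derive; [trivial|ring].
- intros u _. apply (continuity_pt_plus f (fun u => A * u ^ 2)); [apply frame_f_continuous|].
  apply derivable_continuous_pt. reg.
- rewrite Rmin_left, Rmax_right in Hc by lra.
  enough (0 <= df c + 2 * A * c) by nra.
  destruct (Req_dec c 0) as [->|Hc0]; [rewrite frame_df0; lra|].
  specialize (Hdel c Hc0). rewrite Rplus_0_l, frame_df0 in Hdel.
  rewrite Rabs_pos_eq in Hdel by lra.
  specialize (Hdel ltac:(pose proof (cond_pos del); lra)).
  apply Rabs_def2 in Hdel. destruct Hdel as [_ Hdel].
  assert (Hq : - 2 * A < (df c - 0) / c) by lra.
  apply (Rmult_lt_compat_r c) in Hq; [|lra].
  replace ((df c - 0) / c * c) with (df c) in Hq by (field; lra). lra.
Qed.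

Lemma frame_g_lower (B : R) :
  B < dg 0 -> exists t0, 0 < t0 /\ forall t, 0 <= t <= t0 -> B * t <= g t.
Proof.
intros HB. pose proof (of_dg _ _ _ _ Hfr 0) as Hd. apply is_derive_Reals in Hd.
destruct (Hd (dg 0 - B) ltac:(lra)) as [del Hdel].
exists (del / 2). split; [pose proof (cond_pos del); lra|].
intros t Ht. destruct (Req_dec t 0) as [->|Ht0]; [rewrite frame_g0; lra|].
specialize (Hdel t Ht0). rewrite Rplus_0_l, frame_g0 in Hdel.
rewrite Rabs_pos_eq in Hdel by lra.
specialize (Hdel ltac:(pose proof (cond_pos del); lra)).
apply Rabs_def2 in Hdel. destruct Hdel as [_ Hdel].
assert (Hq : B < (g t - 0) / t) by lra.
apply (Rmult_lt_compat_r t) in Hq; [|lra].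
replace ((g t - 0) / t * t) with (g t) in Hq by (field; lra). lra.
Qed.

Lemma chord_ge_f a b : 0 <= a <= 1/4 -> 0 <= b <= 1/4 -> f a + f b <= h a b.
Proof.
intros Ha Hb. pose proof (frame_f_nonneg a Ha). pose proof (frame_f_nonneg b Hb).
rewrite <- (sqrt_square (f a + f b)) by lra. apply sqrt_le_1_alt.
pose proof (Rle_0_sqr (g a + g b)). unfold Rsqr in *. lra.
Qed.

(** With [x], [y], [z] the sums of [f], [g] and the parameters, squaring reduces the claim to [2 * x
    * M * z ^ 2 + M ^ 2 * z ^ 4 <= y ^ 2]. Here [x] is at most [2 * f 0], and [y] is nearly
    [dg 0 * z] for small [z]. *)
Lemma chord_lower (M : R) :
  4 * f 0 * M < dg 0 ^ 2 ->
  exists t0, 0 < t0 <= 1/4 /\ forall a b, 0 <= a <= t0 -> 0 <= b <= t0 ->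
    f a + f b + M * (a + b) ^ 2 <= h a b.
Proof.
intros HM. pose proof (of_f0 _ _ _ _ Hfr) as Hf0.
pose proof (frame_dg_pos 0 ltac:(lra)) as Hrho.
destruct (Rle_dec M 0) as [HM0|HM0].
{ exists (1/4). split; [lra|]. intros a b Ha Hb.
  pose proof (chord_ge_f a b Ha Hb). pose proof (pow2_ge_0 (a + b)). nra. }
assert (HMp : 0 < M) by lra.
(* The midpoint of the two sides of the hypothesis: one half of the gap pays for the lower bound on
   [g], the other for the quartic term. *)
set (B2 := (4 * f 0 * M + dg 0 ^ 2) / 2).
assert (HB2 : 4 * f 0 * M < B2 < dg 0 ^ 2) by (unfold B2; lra).
assert (HB2p : 0 < B2) by nra.
pose proof (sqrt_lt_R0 _ HB2p) as HBp.
pose proof (sqrt_sqrt B2 ltac:(lra)) as HBB.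
set (B := sqrt B2) in *.
assert (HB : B < dg 0) by nra.
destruct (frame_g_lower B HB) as [t1 [Ht1 Hg]].
(* The largest [z ^ 2] for which the quartic term fits in the gap; as [z = a + b], each parameter is
   held below half of its root. *)
set (del := (B2 - 4 * f 0 * M) / (M * M)).
assert (Hdel : 0 < del) by (apply Rdiv_lt_0_compat; nra).
pose proof (sqrt_lt_R0 _ Hdel) as Hsp.
pose proof (sqrt_sqrt del ltac:(lra)) as Hss.
set (t0 := Rmin (Rmin t1 (sqrt del / 2)) (1/4)).
assert (Ht0 : t0 <= t1 /\ t0 <= sqrt del / 2 /\ t0 <= 1/4).
{ unfold t0. repeat split.
  - eapply Rle_trans; [apply Rmin_l|apply Rmin_l].
  - eapply Rle_trans; [apply Rmin_l|apply Rmin_r].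
  - apply Rmin_r. }
exists t0. split.
{ split; [|tauto]. unfold t0. repeat apply Rmin_glb_lt; lra. }
intros a b Ha Hb.
pose proof (Hg a ltac:(lra)). pose proof (Hg b ltac:(lra)).
pose proof (frame_f_nonneg a ltac:(lra)). pose proof (frame_f_nonneg b ltac:(lra)).
pose proof (frame_f_le a ltac:(lra)). pose proof (frame_f_le b ltac:(lra)).
set (x := f a + f b) in *. set (y := g a + g b) in *. set (z := a + b) in *.
assert (Hz : 0 <= z <= sqrt del) by (unfold z; lra).
assert (Hz2 : z ^ 2 <= del) by nra.
assert (Hzz : M * M * z ^ 2 <= B2 - 4 * f 0 * M).
{ replace (B2 - 4 * f 0 * M) with (M * M * del) by (unfold del; field; lra).
  apply Rmult_le_compat_l; nra. }
assert (Hy : B * z <= y) by (unfold y, z; lra).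
assert (Hy2 : B2 * z ^ 2 <= y * y).
{ replace (B2 * z ^ 2) with ((B * z) * (B * z)) by (rewrite <- HBB; ring).
  assert (0 <= B * z) by (apply Rmult_le_pos; lra).
  apply Rmult_le_compat; lra. }
pose proof (pow2_ge_0 z) as Hz0.
assert (Hx : 0 <= x <= 2 * f 0) by (unfold x; lra).
assert (HMz : 0 <= M * z ^ 2) by (apply Rmult_le_pos; lra).
rewrite <- (sqrt_square (x + M * z ^ 2)) by lra.
unfold h, chord. fold x. fold y. apply sqrt_le_1_alt.
assert (2 * x * (M * z ^ 2) <= 4 * f 0 * (M * z ^ 2)) by (apply Rmult_le_compat_r; lra).
assert (M * M * z ^ 2 * z ^ 2 <= (B2 - 4 * f 0 * M) * z ^ 2) by (apply Rmult_le_compat_r; lra).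
nra.
Qed.

Let e (t : R) : R := h t t / 2.

(* The recurrence for [w] is that of [cos (PI * (2 * i + 1) / (2 * s))] with [c = cos (PI / s)], and makes the quadratic lower bound telescope. *)
Lemma chain_lower (A M c t0 : R) (n : nat) (w : nat -> R) :
  (forall a b, 0 <= a <= t0 -> 0 <= b <= t0 ->
     2 * f 0 - A * (a ^ 2 + b ^ 2) + M * (a + b) ^ 2 <= h a b) ->
  A <= M * (1 + c) ->
  (forall i, (i <= n)%nat -> 0 <= w i <= t0) ->
  w 1%nat + w 0%nat = 2 * c * w 0%nat ->
  (forall i, w (S (S i)) + w i = 2 * c * w (S i)) ->
  (2 * INR n + 1) * f 0 + 2 * (M * (1 + c) - A) * w O ^ 2
    + A * w n ^ 2 - M * w n * (w n + w (S n)) <= chain e h n w.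
Proof.
intros Hh HA Hw H01 Hrec. induction n as [|n IH].
- simpl chain. pose proof (Hh (w O) (w O) (Hw O (le_n _)) (Hw O (le_n _))).
  unfold e. simpl INR.
  replace (w 1%nat) with (2 * c * w O - w O) by lra. nra.
- specialize (IH ltac:(intros; apply Hw; lia)). simpl chain.
  pose proof (Hh (w n) (w (S n)) (Hw n ltac:(lia)) (Hw (S n) ltac:(lia))).
  rewrite S_INR.
  replace (w (S (S n))) with (2 * c * w (S n) - w n) by (specialize (Hrec n); lra).
  assert (0 <= (M * (1 + c) - A) * w (S n) ^ 2)
    by (apply Rmult_le_pos; [lra|apply pow2_ge_0]).
  nra.
Qed.

(** * Interior maximisers are critical *)

Definition left_force (w : nat -> R) (i : nat) : R :=
  match i with O => D (w O) (w O) | S k => D (w i) (w k) end.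

Definition right_force (dr : R -> R) (n : nat) (w : nat -> R) (i : nat) : R :=
  if Nat.eqb i n then dr (w n) else D (w i) (w (S i)).

(** The signs of [dr] at the two ends do for the right boundary term what the force bounds do for
    the bonds. The competitor [v] rules out the zero configuration as a maximiser. *)
Lemma exists_interior_critical (n : nat) (r dr : R -> R) (v : nat -> R) :
  (forall t, 0 <= t <= 1/4 -> is_derive r t (dr t)) ->
  0 <= dr 0 -> dr (1/4) < 0 ->
  (forall i, 0 <= v i <= 1/4) ->
  chain e h n (fun _ => 0) + r 0 < chain e h n v + r (v n) ->
  exists u : nat -> R, (forall i, (i <= n)%nat -> 0 < u i < 1/4) /\
    forall i, (i <= n)%nat -> left_force u i + right_force dr n u i = 0.
Proof.
intros Hr Hr0 Hr4 Hv Hlt.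
assert (Hde : forall t, 0 <= t <= 1/4 -> is_derive e t (D t t)).
{ intros t Ht. apply is_derive_chord_diag, chord_pos; assumption. }
assert (Hcont : forall k dk, (forall t, 0 <= t <= 1/4 -> is_derive k t (dk t)) ->
  forall t, 0 <= t <= 1/4 -> continuity_pt k t).
{ intros k dk Hk t Ht. apply derivable_continuous_pt. exists (dk t). apply is_derive_Reals, Hk, Ht. }
destruct (chain_max 0 (1/4) h r ltac:(lra) chord_continuous (Hcont _ _ Hr) n e (Hcont _ _ Hde))
  as [u [Hu Hmax]].
assert (Hcrit : forall i, (i <= n)%nat ->
  (u i < 1/4 -> left_force u i + right_force dr n u i <= 0) /\
  (0 < u i -> 0 <= left_force u i + right_force dr n u i)).
{ intros i Hi.
  apply (derive_at_max (fun t => left_bond e h u i t + right_bond h r n u i t) 0 (1/4)); auto.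
  - lra.
  - intros t Ht. pose proof (chain_upd e h r u n i t Hi).
    specialize (Hmax (upd u i t)). cut (chain e h n (upd u i t) + r (upd u i t n) <= chain e h n u + r (u n)); [lra|].
    apply Hmax. intros k. unfold upd. destruct (Nat.eqb k i); auto.
  - apply (is_derive_plus (left_bond e h u i) (right_bond h r n u i)).
    + destruct i as [|k]; simpl; [apply Hde, Hu|]. apply is_derive_chord_r, chord_pos; apply Hu.
    + unfold right_bond, right_force. destruct (Nat.eqb_spec i n) as [->|].
      * apply Hr, Hu.
      * apply is_derive_chord, chord_pos; apply Hu. }
assert (Hzero : forall i, (i <= n)%nat -> u i <> 0).
(* At a zero all forces are nonnegative while their sum is nonpositive, so each bond force vanishes
   and each neighbour is zero. *)
{ assert (Hnb : forall i, (i <= n)%nat -> u i = 0 ->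
    (forall k, i = S k -> u k = 0) /\ ((i < n)%nat -> u (S i) = 0)).
  { intros i Hi H0. destruct (Hcrit i Hi) as [Hc _]. rewrite H0 in Hc. specialize (Hc ltac:(lra)).
    assert (HL : 0 <= left_force u i).
    { destruct i; simpl; rewrite H0; apply force_zero_nonneg; [lra|apply Hu]. }
    assert (HR : 0 <= right_force dr n u i).
    { unfold right_force. destruct (Nat.eqb_spec i n) as [<-|]; rewrite H0; [lra|].
      apply force_zero_nonneg, Hu. }
    split.
    - intros k ->. simpl in *. rewrite H0 in HL, Hc.
      destruct (Req_dec (u k) 0) as [|Hk]; [assumption|exfalso].
      pose proof (Hu k). pose proof (force_zero_pos (u k) ltac:(lra)). lra.
    - intros Hin. unfold right_force in *. destruct (Nat.eqb_spec i n) as [|]; [lia|].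
      rewrite H0 in HR, Hc. destruct (Req_dec (u (S i)) 0) as [|Hk]; [assumption|exfalso].
      pose proof (Hu (S i)). pose proof (force_zero_pos (u (S i)) ltac:(lra)). lra. }
  intros i Hi H0.
  assert (H00 : u O = 0).
  { clear - Hi H0 Hnb. induction i as [|i IH]; [assumption|].
    apply IH; [lia|]. exact (proj1 (Hnb (S i) Hi H0) i eq_refl). }
  assert (Hall : forall k, (k <= n)%nat -> u k = 0).
  { induction k as [|k IH]; intros Hk; [assumption|].
    apply (Hnb k); [lia|apply IH; lia|lia]. }
  rewrite (chain_ext e h n (fun _ => 0) u) in Hlt by (intros k Hk; symmetry; auto).
  specialize (Hmax v Hv). rewrite (Hall n (le_n _)) in Hmax. lra. }
assert (Hquarter : forall i, (i <= n)%nat -> u i <> 1/4).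
(* At [1/4] all forces are nonpositive while their sum is nonnegative. At the last index
   [dr (1/4) < 0] forbids this, so the value [1/4] would have to pass to the right forever. *)
{ assert (Hnb : forall i, (i <= n)%nat -> u i = 1/4 -> (i < n)%nat /\ u (S i) = 1/4).
  { intros i Hi H4. destruct (Hcrit i Hi) as [_ Hc]. rewrite H4 in Hc. specialize (Hc ltac:(lra)).
    assert (HL : left_force u i <= 0).
    { destruct i; simpl; rewrite H4; apply force_quarter_nonpos; [lra|apply Hu]. }
    unfold right_force in Hc. destruct (Nat.eqb_spec i n) as [->|Hne]; rewrite H4 in Hc; [lra|].
    split; [lia|]. destruct (Req_dec (u (S i)) (1/4)) as [|Hk]; [assumption|exfalso].
    pose proof (Hu (S i)). pose proof (force_quarter_neg (u (S i)) ltac:(lra)). lra. }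
  intros i Hi H4. remember (n - i)%nat as j eqn:Hj. revert i Hi H4 Hj.
  induction j as [|j IH]; intros i Hi H4 Hj; destruct (Hnb i Hi H4) as [Hlt' H4']; [lia|].
  apply (IH (S i)); [lia|assumption|lia]. }
assert (Hint : forall i, (i <= n)%nat -> 0 < u i < 1/4).
{ intros i Hi. pose proof (Hu i). pose proof (Hzero i Hi). pose proof (Hquarter i Hi). lra. }
exists u. split; [assumption|].
intros i Hi. destruct (Hcrit i Hi) as [H1 H2]. pose proof (Hint i Hi).
specialize (H1 ltac:(lra)). specialize (H2 ltac:(lra)). lra.
Qed.

Lemma chord_origin : h 0 0 = 2 * f 0.
Proof.
pose proof (of_f0 _ _ _ _ Hfr). unfold h, chord. rewrite frame_g0.
replace ((f 0 + f 0) * (f 0 + f 0) + (0 + 0) * (0 + 0)) with ((2 * f 0) * (2 * f 0)) by ring.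
apply sqrt_square. lra.
Qed.

Lemma chain_origin (n : nat) : chain e h n (fun _ => 0) = (2 * INR n + 1) * f 0.
Proof.
induction n as [|n IH]; simpl chain.
- unfold e. rewrite chord_origin. simpl. field.
- rewrite IH, chord_origin, S_INR. ring.
Qed.

(* The quantity [A] slightly exceeds half the normal acceleration and [M] is slightly below half the transverse stiffness of the chord; both have room because of the curvature condition. *)
Lemma exists_quadratic_bound (d2 q : R) :
  is_derive df 0 d2 -> 0 < q -> - d2 * f 0 < q * dg 0 ^ 2 ->
  exists A M t0, 0 < t0 <= 1/4 /\ A < M * (2 * q) /\
    (forall a, 0 <= a <= t0 -> f 0 - A * a ^ 2 <= f a) /\
    (forall a b, 0 <= a <= t0 -> 0 <= b <= t0 ->
      2 * f 0 - A * (a ^ 2 + b ^ 2) + M * (a + b) ^ 2 <= h a b).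
Proof.
intros Hd2 Hq Hcond. pose proof (of_f0 _ _ _ _ Hfr) as Hf0.
set (T := q * dg 0 ^ 2 / (2 * f 0)). set (K := - d2 / 2).
assert (HKT : K < T).
{ apply Rmult_lt_reg_r with (2 * f 0); [lra|]. unfold T, K.
  replace (q * dg 0 ^ 2 / (2 * f 0) * (2 * f 0)) with (q * dg 0 ^ 2) by (field; lra). lra. }
(* The order is [K < A < N < T]: the first gap serves the bound on [f], the middle one the strict
   gain, the last one the bound on the chord. *)
set (A := K + (T - K) / 3). set (N := K + 2 * (T - K) / 3). set (M := N / (2 * q)).
assert (HMN : M * (2 * q) = N) by (unfold M; field; lra).
destruct (frame_f_lower d2 A Hd2 ltac:(unfold A, K in *; lra)) as [t1 [Ht1 Hf]].
destruct (chord_lower M) as [t2 [Ht2 Hh]].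
{ replace (4 * f 0 * M) with (N * (2 * f 0 / q)) by (unfold M; field; lra).
  replace (dg 0 ^ 2) with (T * (2 * f 0 / q)) by (unfold T; field; lra).
  apply Rmult_lt_compat_r; [apply Rdiv_lt_0_compat; lra|unfold N; lra]. }
exists A, M, (Rmin t1 t2).
assert (Hl1 : Rmin t1 t2 <= t1) by apply Rmin_l.
assert (Hl2 : Rmin t1 t2 <= t2) by apply Rmin_r.
assert (Hl0 : 0 < Rmin t1 t2) by (apply Rmin_glb_lt; lra).
repeat split; try lra.
- rewrite HMN. unfold A, N. lra.
- intros a Ha. apply Hf. lra.
- intros a b Ha Hb.
  pose proof (Hh a b ltac:(lra) ltac:(lra)). pose proof (Hf a ltac:(lra)). pose proof (Hf b ltac:(lra)). lra.
Qed.

(** The parity of [s] fixes the value after the quarter: for odd [s] the antisymmetry forces a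
    middle [0], for even [s] it gives [- u n]. *)
Lemma exists_quarter_orbit (s n : nat) (odd : bool) (d2 : R) :
  s = (2 * S n + (if odd then 1 else 0))%nat ->
  is_derive df 0 d2 ->
  - d2 * f 0 < cos (PI / (2 * INR s)) ^ 2 * dg 0 ^ 2 ->
  exists u : nat -> R, (forall i, (i <= n)%nat -> 0 < u i < 1/4) /\
    forall i, (i <= n)%nat ->
      left_force u i + (if Nat.eqb i n then D (u n) (if odd then 0 else - u n) else D (u i) (u (S i))) = 0.
Proof.
intros Hs Hd2 Hcond. pose proof PI_RGT_0 as Hpi.
assert (HsR : INR s = 2 * INR n + 2 + (if odd then 1 else 0)).
{ rewrite Hs, plus_INR, mult_INR, (S_INR n). destruct odd; simpl; ring. }
pose proof (pos_INR n) as Hn0.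
assert (Hs2 : 2 * INR n + 2 <= INR s) by (rewrite HsR; destruct odd; lra).
set (th := PI / (2 * INR s)) in *.
assert (Hths : th * (2 * INR s) = PI) by (unfold th; field; lra).
assert (Hth : 0 < th) by (apply Rdiv_lt_0_compat; lra).
assert (Hcos : 0 < cos th) by (apply cos_gt_0; nra).
destruct (exists_quadratic_bound d2 (cos th ^ 2) Hd2 ltac:(nra) Hcond)
  as [A [M [t0 [Ht0 [HAM [Hf Hh]]]]]].
set (w := fun i : nat => t0 * cos (th * (2 * INR i + 1))).
assert (Hw : forall i, (i <= n)%nat -> 0 <= w i <= t0).
{ intros i Hi. apply le_INR in Hi. pose proof (pos_INR i).
  pose proof (COS_bound (th * (2 * INR i + 1))).
  assert (0 <= cos (th * (2 * INR i + 1))).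
  { apply cos_ge_0; nra. }
  unfold w. split; nra. }
assert (Hrec : forall x, cos (th * (x + 2)) + cos (th * (x - 2)) = 2 * cos (2 * th) * cos (th * x)).
{ intros x. replace (th * (x + 2)) with (th * x + 2 * th) by ring.
  replace (th * (x - 2)) with (th * x - 2 * th) by ring.
  rewrite cos_plus, cos_minus. ring. }
assert (H01 : w 1%nat + w O = 2 * cos (2 * th) * w O).
{ unfold w. simpl INR. pose proof (Hrec 1) as H.
  replace (th * (1 - 2)) with (- (th * 1)) in H by ring. rewrite cos_neg in H.
  replace (2 * 1 + 1) with (1 + 2) by ring. replace (2 * 0 + 1) with 1 by ring.
  rewrite <- Rmult_plus_distr_l, H. ring. }
assert (Hwrec : forall i, w (S (S i)) + w i = 2 * cos (2 * th) * w (S i)).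
{ intros i. unfold w. rewrite !S_INR. pose proof (Hrec (2 * (INR i + 1) + 1)) as H.
  replace (2 * (INR i + 1 + 1) + 1) with (2 * (INR i + 1) + 1 + 2) by ring.
  replace (2 * INR i + 1) with (2 * (INR i + 1) + 1 - 2) by ring.
  rewrite <- Rmult_plus_distr_l, H. ring. }
(* This identity matches the requirement of [chain_lower] with the factor [2 * q] of the quadratic
   bound, for [q = cos th ^ 2]. *)
assert (Hc1 : 1 + cos (2 * th) = 2 * cos th ^ 2) by (rewrite cos_2a_cos; ring).
pose proof (chain_lower A M (cos (2 * th)) t0 n w Hh ltac:(rewrite Hc1; lra) Hw H01 Hwrec) as Hlow.
rewrite Hc1 in Hlow.
assert (Hw0 : 0 < w O).
{ unfold w. simpl INR. replace (th * (2 * 0 + 1)) with th by ring. nra. }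
assert (Hgain : 0 < 2 * (M * (2 * cos th ^ 2) - A) * w O ^ 2) by (apply Rmult_lt_0_compat; nra).
assert (Hwn : w (S n) = if odd then 0 else - w n).
{ unfold w. rewrite S_INR. destruct odd.
  - replace (th * (2 * (INR n + 1) + 1)) with (PI / 2).
    + rewrite cos_PI2. ring.
    + rewrite <- Hths, HsR. field.
  - replace (th * (2 * (INR n + 1) + 1)) with (- (th * (2 * INR n + 1)) + PI).
    + rewrite neg_cos, cos_neg. ring.
    + rewrite <- Hths, HsR. ring. }
(* The cosine may leave the box beyond index [n], so the competitor is cut off to [0] there. *)
set (v := fun i : nat => if Nat.leb i n then w i else 0).
assert (Hv : forall i, 0 <= v i <= 1/4).
{ intros i. unfold v. destruct (Nat.leb_spec i n) as [Hi|]; [|lra].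
  specialize (Hw i Hi). lra. }
assert (Hvw : forall i, (i <= n)%nat -> v i = w i).
{ intros i Hi. unfold v. now rewrite (proj2 (Nat.leb_le i n) Hi). }
specialize (Hw n (le_n _)).
(* In both parities the end terms left over by [chain_lower] cancel against the quadratic bound for
   the right boundary term, and [Hgain] remains. *)
destruct odd; rewrite Hwn in Hlow.
- destruct (exists_interior_critical n (fun t => h t 0) (fun t => D t 0) v) as [u [Hu1 Hu2]].
  + intros t Ht. apply is_derive_chord, chord_pos; lra.
  + apply force_zero_nonneg. lra.
  + apply force_quarter_neg. lra.
  + exact Hv.
  + rewrite (chain_ext e h n v w Hvw), chain_origin, chord_origin, (Hvw n (le_n _)).
    pose proof (Hh (w n) 0 Hw ltac:(lra)). lra.
  + exists u. split; [assumption|]. intros i Hi. exact (Hu2 i Hi).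
- destruct (exists_interior_critical n f df v) as [u [Hu1 Hu2]].
  + intros t Ht. apply (of_df _ _ _ _ Hfr).
  + rewrite frame_df0. lra.
  + apply frame_df_neg. lra.
  + exact Hv.
  + rewrite (chain_ext e h n v w Hvw), chain_origin, (Hvw n (le_n _)).
    pose proof (Hf (w n) Hw). lra.
  + exists u. split; [assumption|]. intros i Hi. rewrite force_antidiag; [exact (Hu2 i Hi)|].
    pose proof (Hu1 n (le_n _)). apply frame_f_pos. lra.
Qed.

End Frame.

(** * Unfolding a quarter period *)

Definition zsign (q : Z) : R := if Z.even q then 1 else -1.

Lemma zsign_opp (q : Z) : zsign (- q) = zsign q.
Proof. unfold zsign. now rewrite Z.even_opp. Qed.

Lemma zsign_succ (q : Z) : zsign (q + 1) = - zsign q.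
Proof. unfold zsign. rewrite Z.even_add. destruct (Z.even q); simpl; lra. Qed.

Lemma zsign_pred (q : Z) : zsign (q - 1) = - zsign q.
Proof. unfold zsign. rewrite Z.even_sub. destruct (Z.even q); simpl; lra. Qed.

Lemma zsign_sqr (q : Z) : zsign q * zsign q = 1.
Proof. unfold zsign. destruct (Z.even q); lra. Qed.

(** An antisymmetric block of length [s]. When [m] is [s / 2], the default [0] is reached only at
    the middle index of an odd block. *)
Definition half_block (s m : Z) (u : nat -> R) (r : Z) : R :=
  if (r <? m)%Z then u (Z.to_nat r)
  else if (s - 1 - r <? m)%Z then - u (Z.to_nat (s - 1 - r)) else 0.

Definition unfolding (s m : Z) (u : nat -> R) (j : Z) : R :=
  zsign (j / s) * half_block s m u (j mod s).

Lemma half_block_rev (s m : Z) (u : nat -> R) (r : Z) :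
  (2 * m <= s)%Z -> half_block s m u (s - 1 - r) = - half_block s m u r.
Proof.
intros Hm. unfold half_block. replace (s - 1 - (s - 1 - r))%Z with r by ring.
destruct (Z.ltb_spec r m), (Z.ltb_spec (s - 1 - r) m); try lia; lra.
Qed.

Lemma unfolding_shift (s m : Z) (u : nat -> R) (j : Z) :
  (0 < s)%Z -> unfolding s m u (j + s) = - unfolding s m u j.
Proof.
intros Hs. unfold unfolding. replace (j + s)%Z with (j + 1 * s)%Z by ring.
rewrite Z.div_add, Z_mod_plus_full, zsign_succ by lia. ring.
Qed.

(** The reversal sends quotient [q] and remainder [r] to [- (q + 1)] and [s - 1 - r]; each change
    contributes a sign, and the two signs cancel. *)
Lemma unfolding_rev (s m : Z) (u : nat -> R) (j : Z) :
  (0 < s)%Z -> (2 * m <= s)%Z -> unfolding s m u (- 1 - j) = unfolding s m u j.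
Proof.
intros Hs Hm. unfold unfolding.
pose proof (Z.div_mod j s ltac:(lia)) as Hj. pose proof (Z.mod_pos_bound j s Hs) as Hb.
set (q := (j / s)%Z) in *. set (r := (j mod s)%Z) in *.
rewrite <- (Z.div_unique (- 1 - j) s (- (q + 1)) (s - 1 - r)) by lia.
rewrite <- (Z.mod_unique (- 1 - j) s (- (q + 1)) (s - 1 - r)) by lia.
rewrite half_block_rev, zsign_opp, zsign_succ by lia. ring.
Qed.

Lemma unfolding_block (s m : Z) (u : nat -> R) (r : Z) :
  (0 <= r < s)%Z -> unfolding s m u r = half_block s m u r.
Proof.
intros Hr. unfold unfolding. rewrite Z.div_small, Z.mod_small by lia.
unfold zsign. simpl. ring.
Qed.

Lemma Z_shift_ind (s : Z) (P : Z -> Prop) :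
  (0 < s)%Z -> (forall j, P j -> P (j + s)%Z) -> (forall j, P (j + s)%Z -> P j) ->
  (forall r, (0 <= r < s)%Z -> P r) -> forall j, P j.
Proof.
intros Hs Hup Hdown H0.
assert (H : forall k, (0 <= k)%Z -> forall r, (0 <= r < s)%Z -> P (r + k * s)%Z /\ P (r - k * s)%Z).
{ apply (natlike_ind (fun k => forall r, (0 <= r < s)%Z -> P (r + k * s)%Z /\ P (r - k * s)%Z)).
  - intros r Hr. split; [replace (r + 0 * s)%Z with r by ring|replace (r - 0 * s)%Z with r by ring]; auto.
  - intros k Hk IH r Hr. destruct (IH r Hr) as [H1 H2]. split.
    + replace (r + Z.succ k * s)%Z with (r + k * s + s)%Z by ring. now apply Hup.
    + apply Hdown. now replace (r - Z.succ k * s + s)%Z with (r - k * s)%Z by ring. }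
intros j. pose proof (Z.div_mod j s ltac:(lia)) as Hj. pose proof (Z.mod_pos_bound j s Hs) as Hb.
destruct (Z_le_dec 0 (j / s)) as [Hq|Hq].
- destruct (H (j / s)%Z Hq _ Hb) as [H1 _].
  now replace j with (j mod s + j / s * s)%Z by lia.
- destruct (H (- (j / s))%Z ltac:(lia) _ Hb) as [_ H1].
  now replace j with (j mod s - - (j / s) * s)%Z by lia.
Qed.

(* [U] is the deviation from the 2-periodic orbit; the clause [bw_eq] is the reflection law. *)
Record balanced_wave (D : R -> R -> R) (s m : Z) (U : Z -> R) : Prop := {
  bw_m : (1 <= m)%Z /\ (2 * m <= s <= 2 * m + 1)%Z;
  bw_shift : forall j, U (j + s)%Z = - U j;
  bw_rev : forall j, U (- 1 - j)%Z = U j;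
  bw_pos : forall j, (0 <= j < m)%Z -> 0 < U j;
  bw_zero : forall j, (m <= j < s - m)%Z -> U j = 0;
  bw_bound : forall j, - (1/4) < U j < 1/4;
  bw_eq : forall j, D (U j) (U (j - 1)%Z) + D (U j) (U (j + 1)%Z) = 0
}.

Lemma exists_balanced_wave (f g df dg : R -> R) (d2 : R) (s : Z) :
  oval_frame f g df dg -> (2 <= s)%Z ->
  is_derive df 0 d2 ->
  - d2 * f 0 < cos (PI / IZR (2 * s)) ^ 2 * dg 0 ^ 2 ->
  exists m U, balanced_wave (force f g df dg) s m U.
Proof.
intros Hfr Hs Hd2 Hcond.
set (m := (s / 2)%Z).
assert (Hm : (2 * m <= s <= 2 * m + 1)%Z).
{ unfold m. pose proof (Z.div_mod s 2 ltac:(lia)). pose proof (Z.mod_pos_bound s 2 ltac:(lia)). lia. }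
set (n := Z.to_nat (m - 1)).
set (odd := Z.eqb s (2 * m + 1)).
assert (Hodd : (s = 2 * m + (if odd then 1 else 0))%Z) by (unfold odd; destruct (Z.eqb_spec s (2 * m + 1)); lia).
assert (HsN : Z.to_nat s = (2 * S n + (if odd then 1 else 0))%nat) by (destruct odd; unfold n; lia).
assert (HIs : INR (Z.to_nat s) = IZR s) by (rewrite INR_IZR_INZ, Z2Nat.id by lia; reflexivity).
destruct (exists_quarter_orbit f g df dg Hfr (Z.to_nat s) n odd d2 HsN Hd2) as [u [Hu Heq]].
{ rewrite HIs, <- mult_IZR. exact Hcond. }
set (U := unfolding s m u). set (D := force f g df dg) in *.
assert (Hshift : forall j, U (j + s)%Z = - U j) by (intros; apply unfolding_shift; lia).
assert (Hrev : forall j, U (- 1 - j)%Z = U j) by (intros; apply unfolding_rev; lia).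
assert (HU : forall j, (0 <= j < m)%Z -> U j = u (Z.to_nat j)).
{ intros j Hj. unfold U. rewrite unfolding_block by lia. unfold half_block.
  destruct (Z.ltb_spec j m); [reflexivity|lia]. }
assert (Hz : forall j, (m <= j < s - m)%Z -> U j = 0).
{ intros j Hj. unfold U. rewrite unfolding_block by lia. unfold half_block.
  destruct (Z.ltb_spec j m), (Z.ltb_spec (s - 1 - j) m); lia || reflexivity. }
assert (Hback : forall j, U (s - 1 - j)%Z = - U j).
{ intros j. replace (s - 1 - j)%Z with (-1 - j + s)%Z by ring. now rewrite Hshift, Hrev. }
assert (Hpos : forall j, (0 <= j < m)%Z -> 0 < U j < 1/4).
{ intros j Hj. rewrite HU by assumption. apply Hu. unfold n. lia. }
assert (Hopp : forall a b, D (- a) (- b) = - D a b) by (intros; now apply force_opp).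
exists m, U. split; [lia|assumption|assumption|intros; now apply Hpos|assumption| |].
- apply (Z_shift_ind s); [lia| | |].
  + intros j Hj. rewrite Hshift. lra.
  + intros j Hj. rewrite Hshift in Hj. lra.
  + intros r Hr. destruct (Z_lt_dec r m); [pose proof (Hpos r ltac:(lia)); lra|].
    destruct (Z_lt_dec r (s - m)); [rewrite Hz by lia; lra|].
    pose proof (Hpos (s - 1 - r)%Z ltac:(lia)) as H. rewrite Hback in H. lra.
(* The balance [E] inherits the antiperiodicity and the reversal symmetry of [U], so it has to
   vanish only on the quarter and at the possible middle index. *)
- set (E := fun j => D (U j) (U (j - 1)%Z) + D (U j) (U (j + 1)%Z)).
  assert (HEshift : forall j, E (j + s)%Z = - E j).
  { intros j. unfold E. replace (j + s - 1)%Z with (j - 1 + s)%Z by ring.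
    replace (j + s + 1)%Z with (j + 1 + s)%Z by ring. rewrite !Hshift, !Hopp. ring. }
  assert (HErev : forall j, E (-1 - j)%Z = E j).
  { intros j. unfold E. replace (-1 - j - 1)%Z with (-1 - (j + 1))%Z by ring.
    replace (-1 - j + 1)%Z with (-1 - (j - 1))%Z by ring. rewrite !Hrev. ring. }
  assert (HElow : forall j, (0 <= j < m)%Z -> E j = 0).
  { intros j Hj. unfold E. rewrite <- (Heq (Z.to_nat j)) by (unfold n; lia).
    rewrite !(HU j Hj). f_equal.
    - destruct (Z.eq_dec j 0) as [->|Hj0].
      + replace (0 - 1)%Z with (-1 - 0)%Z by ring. rewrite Hrev, HU by lia. reflexivity.
      + rewrite HU by lia. destruct (Z.to_nat j) as [|k] eqn:Hk; [lia|].
        unfold left_force. replace (Z.to_nat (j - 1)) with k by lia. reflexivity.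
    - destruct (Nat.eqb_spec (Z.to_nat j) n) as [Hjn|Hjn].
      + rewrite Hjn. f_equal. assert (Hjm : j = (m - 1)%Z) by (unfold n in Hjn; lia).
        rewrite Hjm. replace (m - 1 + 1)%Z with m by ring.
        destruct odd; [apply Hz; lia|].
        replace m with (s - 1 - (m - 1))%Z at 1 by lia. rewrite Hback, HU by lia. reflexivity.
      + rewrite HU by (unfold n in Hjn; lia). f_equal. f_equal. lia. }
  apply (Z_shift_ind s (fun j => E j = 0)); [lia| | |].
  + intros j Hj. rewrite HEshift, Hj. ring.
  + intros j Hj. rewrite HEshift in Hj. lra.
  + intros r Hr. destruct (Z_lt_dec r m); [apply HElow; lia|].
    destruct (Z_lt_dec r (s - m)).
    * unfold E. rewrite (Hz r) by lia.
      (* At the middle index of an odd block the value is [0] and its neighbours are opposite, so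
         the oddness of [D] cancels their forces. *)
      assert (Hr1 : U (r + 1)%Z = - U (r - 1)%Z).
      { rewrite <- Hback. f_equal. lia. }
      rewrite Hr1. rewrite <- Ropp_0 at 2. rewrite Hopp. ring.
    * pose proof (HElow (s - 1 - r)%Z ltac:(lia)) as H.
      replace (s - 1 - r)%Z with (-1 - r + s)%Z in H by ring.
      rewrite HEshift, HErev in H. lra.
Qed.

(** * Signs and periods of a balanced wave *)

Section Wave.

Variables (D : R -> R -> R) (s m : Z) (U : Z -> R).
Hypothesis HU : balanced_wave D s m U.

Lemma wave_period j : U (j + 2 * s)%Z = U j.
Proof.
replace (j + 2 * s)%Z with (j + s + s)%Z by ring.
rewrite !(bw_shift _ _ _ _ HU). ring.
Qed.

Lemma wave_pos j : (- m <= j < m)%Z -> 0 < U j.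
Proof.
intros Hj. destruct (Z_le_dec 0 j).
- apply (bw_pos _ _ _ _ HU). lia.
- rewrite <- (bw_rev _ _ _ _ HU). apply (bw_pos _ _ _ _ HU). lia.
Qed.

Lemma wave_neg j : (s - m <= j < s + m)%Z -> U j < 0.
Proof.
intros Hj. replace j with (j - s + s)%Z by ring. rewrite (bw_shift _ _ _ _ HU).
pose proof (wave_pos (j - s) ltac:(lia)). lra.
Qed.

Lemma wave_zero j : (s + m <= j < 2 * s - m)%Z -> U j = 0.
Proof.
intros Hj. replace j with (j - s + s)%Z by ring. rewrite (bw_shift _ _ _ _ HU), (bw_zero _ _ _ _ HU) by lia. ring.
Qed.

Lemma wave_nonpos j : (m <= j < 2 * s - m)%Z -> U j <= 0.
Proof.
intros Hj. destruct (Z_lt_dec j (s - m)); [rewrite (bw_zero _ _ _ _ HU) by lia; lra|].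
destruct (Z_lt_dec j (s + m)); [apply Rlt_le, wave_neg; lia|].
rewrite wave_zero by lia. lra.
Qed.

(** The positive values in a period form a single run from [- m] to [m - 1]. A short shift carries
    its right end out of the run, a long one its left end. *)
Lemma wave_no_period q : (0 < q < 2 * s)%Z -> ~ (forall i, U (i + q)%Z = U i).
Proof.
intros Hq Hper. pose proof (bw_m _ _ _ _ HU).
destruct (Z_le_dec q (2 * s - 2 * m)).
- pose proof (wave_nonpos (m - 1 + q) ltac:(lia)) as H1. rewrite Hper in H1.
  pose proof (wave_pos (m - 1) ltac:(lia)). lra.
- pose proof (wave_nonpos (- m + q) ltac:(lia)) as H1. rewrite Hper in H1.
  pose proof (wave_pos (- m) ltac:(lia)). lra.
Qed.

(** Even steps lead from the negative value at [s] to a positive one a period later, and conversely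
    from a positive value to [s]. The positive index used is [0] or [-1] modulo [2 * s], according
    to the parity of [s]. *)
Lemma wave_not_monotone (V : Z -> R) :
  (forall j, V (j + 2)%Z <= V j) -> ~ ((forall j, V j = U j) \/ (forall j, V j = - U j)).
Proof.
intros Hmon.
assert (Hk : forall k, (0 <= k)%Z -> forall j, V (j + 2 * k)%Z <= V j).
{ apply (natlike_ind (fun k => forall j, V (j + 2 * k)%Z <= V j)).
  - intros j. replace (j + 2 * 0)%Z with j by ring. lra.
  - intros k Hk IH j. replace (j + 2 * Z.succ k)%Z with (j + 2 * k + 2)%Z by ring.
    specialize (IH j). specialize (Hmon (j + 2 * k)%Z). lra. }
pose proof (bw_m _ _ _ _ HU) as Hm.
pose proof (wave_neg s ltac:(lia)) as Hs.
pose proof (wave_pos 0 ltac:(lia)) as H0. pose proof (wave_pos (-1) ltac:(lia)) as H1.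
pose proof (wave_period 0) as P0. pose proof (wave_period (-1)) as P1.
destruct (Z.Even_or_Odd s) as [[k Hk2]|[k Hk2]]; intros [HV|HV].
- specialize (Hk k ltac:(lia) s). rewrite !HV in Hk. replace (s + 2 * k)%Z with (0 + 2 * s)%Z in Hk by lia. lra.
- specialize (Hk k ltac:(lia) 0%Z). rewrite !HV in Hk. replace (0 + 2 * k)%Z with s in Hk by lia. lra.
- specialize (Hk k ltac:(lia) s). rewrite !HV in Hk. replace (s + 2 * k)%Z with (-1 + 2 * s)%Z in Hk by lia. lra.
- specialize (Hk (k + 1)%Z ltac:(lia) (-1)%Z). rewrite !HV in Hk. replace (-1 + 2 * (k + 1))%Z with s in Hk by lia. lra.
Qed.

Lemma no_sign_change_within (d : Z -> R) (p i : Z) : 0 < d i * d (i + 1)%Z -> ~ sign_change_at d p i.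
Proof.
intros Hp [Hi [j [Hj [Hlt Hz]]]].
destruct (Z.eq_dec j (i + 1)) as [->|Hne]; [lra|].
rewrite (Hz (i + 1)%Z) in Hp by lia. lra.
Qed.

Lemma wave_sign_changes : num_sign_changes_eq U (2 * s) 2.
Proof.
pose proof (bw_m _ _ _ _ HU) as Hm.
(* The last indices of the positive and the negative run; the next nonzero term skips the middle
   zero, if there is one. *)
exists ((m - 1)%Z :: (s + m - 1)%Z :: nil). split; [|split; [|reflexivity]].
- repeat constructor; simpl; lia.
- intros i. split.
  + intros [<-|[<-|[]]]; (split; [lia|]); split.
    * pose proof (wave_pos (m - 1) ltac:(lia)). lra.
    * exists (s - m)%Z. split; [lia|]. split.
      -- pose proof (wave_pos (m - 1) ltac:(lia)). pose proof (wave_neg (s - m) ltac:(lia)). nra.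
      -- intros k Hk. apply (bw_zero _ _ _ _ HU). lia.
    * pose proof (wave_neg (s + m - 1) ltac:(lia)). lra.
    * exists (2 * s - m)%Z. split; [lia|]. split.
      -- pose proof (wave_neg (s + m - 1) ltac:(lia)). pose proof (wave_pos (- m) ltac:(lia)).
         pose proof (wave_period (- m)) as HP. replace (- m + 2 * s)%Z with (2 * s - m)%Z in HP by ring. nra.
      -- intros k Hk. apply wave_zero. lia.
  + intros [Hi Hsc].
    destruct (Z.eq_dec i (m - 1)) as [->|]; [now left|].
    destruct (Z.eq_dec i (s + m - 1)) as [->|]; [now right; left|]. exfalso.
    destruct (Z_lt_dec i m).
    { revert Hsc. apply no_sign_change_within.
      pose proof (wave_pos i ltac:(lia)). pose proof (wave_pos (i + 1) ltac:(lia)). nra. }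
    destruct (Z_lt_dec i (s - m)); [apply (proj1 Hsc), (bw_zero _ _ _ _ HU); lia|].
    destruct (Z_lt_dec i (s + m)).
    { revert Hsc. apply no_sign_change_within.
      pose proof (wave_neg i ltac:(lia)). pose proof (wave_neg (i + 1) ltac:(lia)). nra. }
    destruct (Z_lt_dec i (2 * s - m)); [apply (proj1 Hsc), wave_zero; lia|].
    revert Hsc. apply no_sign_change_within.
    pose proof (wave_pos (i - 2 * s) ltac:(lia)) as H1. pose proof (wave_pos (i + 1 - 2 * s) ltac:(lia)) as H2.
    rewrite <- wave_period in H1, H2.
    replace (i - 2 * s + 2 * s)%Z with i in H1 by ring.
    replace (i + 1 - 2 * s + 2 * s)%Z with (i + 1)%Z in H2 by ring. nra.
Qed.

End Wave.

(** * From deviations to billiard orbits *)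

Lemma curve_half_turn (gamma : R -> pt) (t : R) (k : Z) :
  billiard_curve gamma ->
  gamma (t + IZR k / 2) = (zsign k * fst (gamma t), zsign k * snd (gamma t)).
Proof.
intros [_ [_ [_ [_ [_ [Hhalf _]]]]]].
apply (Z_shift_ind 1 (fun k => gamma (t + IZR k / 2) = (zsign k * fst (gamma t), zsign k * snd (gamma t)))).
- lia.
- intros j Hj. rewrite plus_IZR. replace (t + (IZR j + 1) / 2) with (t + IZR j / 2 + 1 / 2) by field.
  rewrite Hhalf, Hj, zsign_succ. unfold rotR; simpl. f_equal; ring.
- intros j Hj. rewrite plus_IZR in Hj. replace (t + (IZR j + 1) / 2) with (t + IZR j / 2 + 1 / 2) in Hj by field.
  rewrite Hhalf, zsign_succ in Hj. unfold rotR in Hj.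
  rewrite (surjective_pairing (gamma (t + IZR j / 2))). injection Hj as H1 H2. f_equal; lra.
- intros r Hr. replace r with 0%Z by lia. unfold zsign; simpl.
  replace (t + 0 / 2) with t by field. rewrite !Rmult_1_l. apply surjective_pairing.
Qed.

Lemma curve_period (gamma : R -> pt) (t : R) (k : Z) :
  billiard_curve gamma -> gamma (t + IZR k) = gamma t.
Proof.
intros Hg. replace (t + IZR k) with (t + IZR (2 * k) / 2) by (rewrite mult_IZR; field).
rewrite curve_half_turn by assumption. unfold zsign. rewrite Z.even_mul. simpl.
rewrite !Rmult_1_l. symmetry. apply surjective_pairing.
Qed.

Lemma derive_half_turn (F : R -> R) (a sg t : R) :
  (forall u, ex_derive F u) -> (forall u, F (u + a) = sg * F u) ->
  Derive F (t + a) = sg * Derive F t.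
Proof.
intros Hd Hs.
assert (H1 : is_derive (fun u => F (u + a)) t (Derive F (t + a))).
{ evar (l : R). replace (Derive F (t + a)) with l; [unfold l; apply is_derive_Reals|].
  apply (derivable_pt_lim_comp (fun u => u + a) F).
  apply derivable_pt_lim_plus; [apply derivable_pt_lim_id|apply derivable_pt_lim_const].
  apply is_derive_Reals, Derive_correct, Hd. unfold l. ring. }
assert (H2 : is_derive (fun u => F (u + a)) t (sg * Derive F t)).
{ apply is_derive_ext with (fun u => sg * F u); [intros; now rewrite Hs|].
  apply (is_derive_scal F t sg), Derive_correct, Hd. }
apply is_derive_unique in H1. apply is_derive_unique in H2. congruence.
Qed.

Lemma dcurve_half_turn (gamma : R -> pt) (t : R) (k : Z) :
  billiard_curve gamma ->
  dcurve gamma (t + IZR k / 2) = (zsign k * fst (dcurve gamma t), zsign k * snd (dcurve gamma t)).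
Proof.
intros Hg. assert (Hd : C2_curve gamma) by apply Hg. destruct Hd as [Hd _].
unfold dcurve at 1; simpl. f_equal; apply derive_half_turn; intros u; try apply Hd;
  now rewrite curve_half_turn.
Qed.

(* Coordinates along and across the vector [gamma c], not normalised: they are scaled by its length. *)
Definition along (gamma : R -> pt) (c t : R) : R := dot (gamma c) (gamma (c + t)).
Definition across (gamma : R -> pt) (c t : R) : R := cross (gamma c) (gamma (c + t)).
Definition dalong (gamma : R -> pt) (c t : R) : R := dot (gamma c) (dcurve gamma (c + t)).
Definition dacross (gamma : R -> pt) (c t : R) : R := cross (gamma c) (dcurve gamma (c + t)).

Lemma is_derive_lin (x y : R -> R) (a b c t : R) :
  ex_derive x (c + t) -> ex_derive y (c + t) ->
  is_derive (fun u => a * x (c + u) + b * y (c + u)) t (a * Derive x (c + t) + b * Derive y (c + t)).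
Proof.
intros Hx Hy. auto_derive.
- tauto.
- change (fun u => x u) with x. change (fun u => y u) with y. ring.
Qed.

(** The two cases are a 2-periodic orbit on the horizontal and on the vertical axis. *)
Definition axis_reflection (S : pt -> pt) : Prop :=
  (forall a, S a = reflS a) \/ (forall a, S a = rotRS a).

(** At the centre the half turn would fix the point, against injectivity modulo 1. *)
Lemma curve_center_free (gamma : R -> pt) (t : R) :
  billiard_curve gamma -> 0 < dot (gamma t) (gamma t).
Proof.
intros Hg. apply Rnot_le_lt. intros Hn.
assert (H0 : fst (gamma t) = 0 /\ snd (gamma t) = 0) by (apply Rplus_sqr_eq_0, Rle_antisym; [exact Hn|
  apply Rplus_le_le_0_compat; apply Rle_0_sqr]).
destruct Hg as [_ [_ [_ [Hinj [_ [Hhalf _]]]]]].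
destruct (Hinj (t + 1/2) t) as [n Hn'].
- rewrite Hhalf. rewrite (surjective_pairing (gamma t)). unfold rotR; simpl.
  rewrite (proj1 H0), (proj2 H0), Ropp_0. reflexivity.
- apply (not_integer_between (t + 1/2 - t) 0) with n; [lra|assumption].
Qed.

Lemma curve_frame (gamma : R -> pt) (c : R) (S : pt -> pt) :
  billiard_curve gamma -> axis_reflection S ->
  (forall t, gamma (c - t) = S (gamma (c + t))) ->
  oval_frame (along gamma c) (across gamma c) (dalong gamma c) (dacross gamma c).
Proof.
intros Hg HS Hsym.
pose proof (curve_center_free gamma c Hg) as Hpos.
assert (Hfix : S (gamma c) = gamma c).
{ pose proof (Hsym 0) as H. rewrite Rminus_0_r, Rplus_0_r in H. now symmetry. }
assert (Hrefl : forall a, dot (gamma c) (S a) = dot (gamma c) a /\ cross (gamma c) (S a) = - cross (gamma c) a).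
{ intros a. destruct HS as [HS|HS]; rewrite HS in *; rewrite (surjective_pairing (gamma c)) in Hfix;
    unfold rotRS, rotR, reflS in Hfix; simpl in Hfix; injection Hfix as H1; unfold dot, cross, rotRS, rotR, reflS; simpl.
  - replace (snd (gamma c)) with 0 by lra. split; ring.
  - replace (fst (gamma c)) with 0 by lra. split; ring. }
assert (Hd : forall t, ex_derive (fun u => fst (gamma u)) t /\ ex_derive (fun u => snd (gamma u)) t) by apply Hg.
assert (Hhalf : forall t, gamma (t + 1/2) = rotR (gamma t)) by apply Hg.
split.
- intros t. apply (is_derive_lin (fun u => fst (gamma u)) (fun u => snd (gamma u))); apply Hd.
- intros t. unfold across, dacross, cross.
  replace (fst (gamma c) * snd (dcurve gamma (c + t)) - snd (gamma c) * fst (dcurve gamma (c + t)))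
    with (- snd (gamma c) * fst (dcurve gamma (c + t)) + fst (gamma c) * snd (dcurve gamma (c + t))) by ring.
  apply is_derive_ext with (fun u => - snd (gamma c) * fst (gamma (c + u)) + fst (gamma c) * snd (gamma (c + u))).
  + intros u. simpl. ring.
  + apply (is_derive_lin (fun u => fst (gamma u)) (fun u => snd (gamma u))); apply Hd.
- intros t. unfold along. rewrite <- (proj1 (Hrefl (gamma (c + t)))), <- Hsym. reflexivity.
- intros t. unfold across. rewrite <- (proj2 (Hrefl (gamma (c + t)))), <- Hsym. reflexivity.
- intros t. unfold along. rewrite <- Rplus_assoc, Hhalf. unfold dot, rotR; simpl. ring.
- intros t. unfold across. rewrite <- Rplus_assoc, Hhalf. unfold cross, rotR; simpl. ring.
- unfold along. now rewrite Rplus_0_r.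
- intros s t Hst. destruct Hg as [_ [_ [_ [Hinj [Hconv _]]]]].
  assert (Hne : gamma (c + s) <> gamma (c + t)).
  { intros Heq. destruct (Hinj _ _ Heq) as [n Hn]. apply (Hst n). lra. }
  pose proof (Hconv _ _ Hne) as Hc.
  (* Passing to these coordinates multiplies cross products by the squared length of [gamma c]. *)
  replace (dalong gamma c t * (across gamma c s - across gamma c t)
           - dacross gamma c t * (along gamma c s - along gamma c t))
    with (dot (gamma c) (gamma c) * cross (dcurve gamma (c + t)) (vsub (gamma (c + s)) (gamma (c + t)))).
  + apply Rmult_lt_0_compat; lra.
  + unfold along, across, dalong, dacross, dot, cross, vsub; simpl. ring.
Qed.

(** Up to the positive factor [vnorm (gamma c)], the force is the tangential component of a unit
    chord vector, which is the quantity compared in the reflection law. *)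
Lemma force_chord (gamma : R -> pt) (c a b : R) :
  0 < dot (gamma c) (gamma c) ->
  let v := (fst (gamma (c + a)) + fst (gamma (c + b)), snd (gamma (c + a)) + snd (gamma (c + b))) in
  force (along gamma c) (across gamma c) (dalong gamma c) (dacross gamma c) a b =
  vnorm (gamma c) * (dot v (dcurve gamma (c + a)) / vnorm v).
Proof.
intros Hpos v. unfold force, chord.
pose proof (sqrt_lt_R0 _ Hpos) as Hl. pose proof (sqrt_sqrt _ (Rlt_le _ _ Hpos)) as Hll.
replace ((along gamma c a + along gamma c b) * (along gamma c a + along gamma c b) +
   (across gamma c a + across gamma c b) * (across gamma c a + across gamma c b))
  with (dot (gamma c) (gamma c) * dot v v) by (unfold v, along, across, dot, cross; simpl; ring).
replace (dalong gamma c a * (along gamma c a + along gamma c b) +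
   dacross gamma c a * (across gamma c a + across gamma c b))
  with (dot (gamma c) (gamma c) * dot v (dcurve gamma (c + a)))
  by (unfold v, along, across, dalong, dacross, dot, cross; simpl; ring).
rewrite sqrt_mult_alt by lra. unfold vnorm, Rdiv. rewrite Rinv_mult.
rewrite <- Hll at 1. set (l := sqrt (dot (gamma c) (gamma c))) in *.
transitivity (l * / l * (l * (dot v (dcurve gamma (c + a)) * / sqrt (dot v v)))); [ring|].
rewrite Rinv_r by lra. ring.
Qed.

Definition wave_lift (c : R) (U : Z -> R) (i : Z) : R := c + IZR i / 2 + U i.

(** Consecutive points carry opposite signs [zsign], so the differences of points become sums with
    opposite signs, and equality of tangential components becomes vanishing of the total force. *)
Lemma wave_reflection_law (gamma : R -> pt) (c : R) (U : Z -> R) (i : Z) :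
  billiard_curve gamma ->
  let D := force (along gamma c) (across gamma c) (dalong gamma c) (dacross gamma c) in
  D (U i) (U (i - 1)%Z) + D (U i) (U (i + 1)%Z) = 0 ->
  reflection_law gamma (fun j => gamma (wave_lift c U j)) i.
Proof.
intros Hg D HD. exists (wave_lift c U i). split; [reflexivity|].
pose proof (curve_center_free gamma c Hg) as Hpos.
unfold D in HD. rewrite !force_chord in HD by assumption.
rewrite <- Rmult_plus_distr_l in HD. apply Rmult_integral in HD.
destruct HD as [HD|HD]; [pose proof (sqrt_lt_R0 _ Hpos); unfold vnorm in HD; lra|].
assert (Hz : forall j, gamma (wave_lift c U j) = (zsign j * fst (gamma (c + U j)), zsign j * snd (gamma (c + U j)))).
{ intros j. unfold wave_lift. replace (c + IZR j / 2 + U j) with (c + U j + IZR j / 2) by ring.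
  now apply curve_half_turn. }
assert (Hdz : dcurve gamma (wave_lift c U i) = (zsign i * fst (dcurve gamma (c + U i)), zsign i * snd (dcurve gamma (c + U i)))).
{ unfold wave_lift. replace (c + IZR i / 2 + U i) with (c + U i + IZR i / 2) by ring.
  now apply dcurve_half_turn. }
rewrite Hdz, !Hz, zsign_succ, zsign_pred.
pose proof (zsign_sqr i) as Hs.
set (sg := zsign i) in *. set (d := dcurve gamma (c + U i)) in *.
set (p := gamma (c + U (i + 1)%Z)) in *. set (q := gamma (c + U i)) in *.
set (r := gamma (c + U (i - 1)%Z)) in *.
clearbody sg d p q r.
assert (Hn1 : vnorm (vsub (- sg * fst p, - sg * snd p) (sg * fst q, sg * snd q)) = vnorm (fst q + fst p, snd q + snd p)).
{ unfold vnorm. f_equal. unfold dot, vsub; simpl.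
  transitivity (sg * sg * ((fst q + fst p) * (fst q + fst p) + (snd q + snd p) * (snd q + snd p))); [ring|rewrite Hs; ring]. }
assert (Hn2 : vnorm (vsub (sg * fst q, sg * snd q) (- sg * fst r, - sg * snd r)) = vnorm (fst q + fst r, snd q + snd r)).
{ unfold vnorm. f_equal. unfold dot, vsub; simpl.
  transitivity (sg * sg * ((fst q + fst r) * (fst q + fst r) + (snd q + snd r) * (snd q + snd r))); [ring|rewrite Hs; ring]. }
rewrite Hn1, Hn2.
assert (Hd1 : dot (vsub (- sg * fst p, - sg * snd p) (sg * fst q, sg * snd q)) (sg * fst d, sg * snd d)
  = - dot (fst q + fst p, snd q + snd p) d).
{ unfold dot, vsub; simpl.
  transitivity (sg * sg * - ((fst q + fst p) * fst d + (snd q + snd p) * snd d)); [ring|rewrite Hs; ring]. }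
assert (Hd2 : dot (vsub (sg * fst q, sg * snd q) (- sg * fst r, - sg * snd r)) (sg * fst d, sg * snd d)
  = dot (fst q + fst r, snd q + snd r) d).
{ unfold dot, vsub; simpl.
  transitivity (sg * sg * ((fst q + fst r) * fst d + (snd q + snd r) * snd d)); [ring|rewrite Hs; ring]. }
rewrite Hd1, Hd2. unfold Rdiv in *. lra.
Qed.

Lemma curvature_condition (gamma : R -> pt) (c q : R) (S : pt -> pt) :
  billiard_curve gamma -> axis_reflection S ->
  (forall t, gamma (c - t) = S (gamma (c + t))) ->
  curvature gamma c * vnorm (vsub (rotR (gamma c)) (gamma c)) < 2 * q ->
  is_derive (dalong gamma c) 0 (dot (gamma c) (ddcurve gamma c)) /\
  - dot (gamma c) (ddcurve gamma c) * along gamma c 0 < q * dacross gamma c 0 ^ 2.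
Proof.
intros Hg HS Hsym Hk.
pose proof (curve_frame gamma c S Hg HS Hsym) as Hfr.
pose proof (curve_center_free gamma c Hg) as Hpos.
split.
{ assert (Hd : C2_curve gamma) by apply Hg. destruct Hd as [_ [Hd _]].
  pose proof (is_derive_lin (fun u => fst (dcurve gamma u)) (fun u => snd (dcurve gamma u))
    (fst (gamma c)) (snd (gamma c)) c 0 (proj1 (Hd _)) (proj2 (Hd _))) as H.
  rewrite Rplus_0_r in H. exact H. }
pose proof (frame_df0 _ _ _ _ Hfr) as H0.
pose proof (frame_dg_pos _ _ _ _ Hfr 0 ltac:(lra)) as Hrho.
unfold dalong in H0. unfold dacross in *. unfold along. rewrite !Rplus_0_r in *.
assert (Hl : vnorm (vsub (rotR (gamma c)) (gamma c)) = 2 * vnorm (gamma c)).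
{ unfold vnorm. replace (dot (vsub (rotR (gamma c)) (gamma c)) (vsub (rotR (gamma c)) (gamma c)))
    with (2 * 2 * dot (gamma c) (gamma c)) by (unfold dot, vsub, rotR; simpl; ring).
  rewrite sqrt_mult_alt, sqrt_square by lra. reflexivity. }
rewrite Hl in Hk. unfold curvature in Hk.
set (P := gamma c) in *. set (v := dcurve gamma c) in *. set (a := ddcurve gamma c) in *.
clearbody P v a.
(* By symmetry the tangent [v] is orthogonal to [P], so one term of the Lagrange identity drops out,
   both here and in [Hca]. *)
assert (Hvv : dot P P * dot v v = cross P v ^ 2).
{ transitivity (dot P v ^ 2 + cross P v ^ 2); [unfold dot, cross; ring|rewrite H0; ring]. }
assert (Hca : dot P P * cross v a = - (cross P v * dot P a)).
{ transitivity (dot P v * cross P a - cross P v * dot P a); [unfold dot, cross; ring|rewrite H0; ring]. }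
assert (Hv : 0 < dot v v) by (apply Rmult_lt_reg_l with (dot P P); [exact Hpos|]; rewrite Hvv; nra).
pose proof (sqrt_lt_R0 _ Hpos) as Hn1. pose proof (sqrt_sqrt _ (Rlt_le _ _ Hpos)) as Hn2.
pose proof (sqrt_lt_R0 _ Hv) as Hn3. pose proof (sqrt_sqrt _ (Rlt_le _ _ Hv)) as Hn4.
fold (vnorm P) in Hn1, Hn2. fold (vnorm v) in Hn3, Hn4.
set (l := vnorm P) in *. set (n := vnorm v) in *.
assert (Hcr : cross P v = l * n).
{ apply Rsqr_inj; [lra|nra|]. unfold Rsqr. transitivity (cross P v ^ 2); [ring|]. rewrite <- Hvv, <- Hn2, <- Hn4. ring. }
assert (Hcv : cross v a = - (n * dot P a / l)).
{ apply Rmult_eq_reg_l with (dot P P); [|lra]. rewrite Hca, Hcr, <- Hn2. field. lra. }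
assert (Hk2 : - (2 * dot P a / (n * n)) < 2 * q).
{ replace (- (2 * dot P a / (n * n))) with (cross v a / n ^ 3 * (2 * l)); [exact Hk|].
  rewrite Hcv. field. lra. }
assert (Hk3 : - dot P a < q * (n * n)).
{ apply Rmult_lt_compat_r with (r := n * n / 2) in Hk2; [|nra].
  replace (- (2 * dot P a / (n * n)) * (n * n / 2)) with (- dot P a) in Hk2 by (field; lra). lra. }
rewrite Hcr. replace (q * (l * n) ^ 2) with (q * (n * n) * dot P P) by (rewrite <- Hn2; ring).
now apply Rmult_lt_compat_r.
Qed.

(** * Symmetry axis of the 2-periodic orbit *)

Lemma periodic_2_value (Z0 : Z -> pt) (k : Z) :
  periodic Z0 2 -> Z0 k = if Z.even k then Z0 0%Z else Z0 1%Z.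
Proof.
intros Hp. apply (Z_shift_ind 2 (fun k => Z0 k = if Z.even k then Z0 0%Z else Z0 1%Z)).
- lia.
- intros j Hj. rewrite Hp, Hj, Z.even_add. now destruct (Z.even j).
- intros j Hj. rewrite Hp, Z.even_add in Hj. rewrite Hj. now destruct (Z.even j).
- intros r Hr. assert (Hr' : r = 0%Z \/ r = 1%Z) by lia. now destruct Hr' as [-> | ->].
Qed.

Lemma rotR_ne (gamma : R -> pt) (t : R) : billiard_curve gamma -> rotR (gamma t) <> gamma t.
Proof.
intros Hg Heq. pose proof (curve_center_free gamma t Hg) as Hpos.
rewrite (surjective_pairing (gamma t)) in Heq. unfold rotR in Heq; simpl in Heq.
injection Heq as H1 H2. unfold dot in Hpos.
replace (fst (gamma t)) with 0 in Hpos by lra. replace (snd (gamma t)) with 0 in Hpos by lra. lra.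
Qed.

Lemma symmetric_value_cases (Z0 : Z -> pt) (g : pt -> pt) :
  periodic Z0 2 -> g_symmetric g Z0 -> g (Z0 0%Z) = Z0 0%Z \/ g (Z0 0%Z) = Z0 1%Z.
Proof.
intros Hp [k [Hk|Hk]]; rewrite Hk, periodic_2_value by assumption;
  match goal with |- context [Z.even ?j] => destruct (Z.even j) end; tauto.
Qed.

(** The half turn fixes no point of the curve, hence swaps the two points. The reflection [reflS]
    keeps or swaps them, so [- c] and [c] differ by a half-integer, whose parity [n] selects the
    mirror. *)
Lemma two_periodic_axis (gamma : R -> pt) (Z0 : Z -> pt) (c : R) :
  billiard_curve gamma -> periodic Z0 2 -> D2_symmetric Z0 -> gamma c = Z0 0%Z ->
  Z0 1%Z = rotR (gamma c) /\
  exists S, axis_reflection S /\ forall t, gamma (c - t) = S (gamma (c + t)).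
Proof.
intros Hg Hp [_ [HR [HS _]]] Hc.
assert (HZ1 : Z0 1%Z = rotR (gamma c)).
{ destruct (symmetric_value_cases Z0 rotR Hp HR) as [H|H]; rewrite <- Hc in H; [|now symmetry].
  now apply rotR_ne in H. }
split; [assumption|].
pose proof Hg as [_ [_ [_ [Hinj [_ [Hhalf Hrefl]]]]]].
assert (Hfold : exists n : Z, - c - c = IZR n / 2).
{ destruct (symmetric_value_cases Z0 reflS Hp HS) as [H|H]; rewrite <- Hc, <- Hrefl in H.
  - destruct (Hinj _ _ H) as [n Hn]. exists (2 * n)%Z. rewrite mult_IZR. lra.
  - rewrite HZ1, <- Hhalf in H. destruct (Hinj _ _ H) as [n Hn].
    exists (2 * n + 1)%Z. rewrite plus_IZR, mult_IZR. lra. }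
destruct Hfold as [n Hn].
assert (Hmir : forall t, gamma (c - t) = reflS (zsign n * fst (gamma (c + t)), zsign n * snd (gamma (c + t)))).
{ intros t. rewrite <- curve_half_turn by assumption. rewrite <- Hrefl.
  replace (- (c + t + IZR n / 2)) with (c - t) by lra. reflexivity. }
unfold zsign in Hmir. destruct (Z.even n).
- exists reflS. split; [left; reflexivity|]. intros t. rewrite Hmir. unfold reflS; simpl. f_equal; ring.
- exists rotRS. split; [right; reflexivity|]. intros t. rewrite Hmir. unfold rotRS, rotR, reflS; simpl. f_equal; ring.
Qed.

Lemma curve_eq_integer (gamma : R -> pt) (s t : R) :
  billiard_curve gamma -> gamma s = gamma t -> exists n : Z, s - t = IZR n.
Proof. intros Hg. apply Hg. Qed.

(** * The billiard orbit carried by a balanced wave *)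

Section Orbit.

Variables (gamma : R -> pt) (c : R) (S : pt -> pt) (D : R -> R -> R) (s m : Z) (U : Z -> R).
Hypothesis Hg : billiard_curve gamma.
Hypothesis HU : balanced_wave D s m U.

Let x := wave_lift c U.
Let z := fun i => gamma (x i).

Lemma wave_lift_step i : 0 < x (i + 1)%Z - x i < 1.
Proof.
unfold x, wave_lift. rewrite plus_IZR.
pose proof (bw_bound _ _ _ _ HU i). pose proof (bw_bound _ _ _ _ HU (i + 1)%Z). lra.
Qed.

Lemma wave_is_lift : is_lift gamma z x.
Proof. intros i. split; [reflexivity|apply wave_lift_step]. Qed.

Lemma wave_in_X : in_X (2 * s) s x.
Proof.
intros i. unfold x, wave_lift. rewrite (wave_period _ _ _ _ HU), plus_IZR, mult_IZR. field.
Qed.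

Lemma wave_billiard_sequence : billiard_sequence gamma z.
Proof.
split; [intros i; exists (x i); reflexivity|].
intros i Heq. destruct (curve_eq_integer gamma _ _ Hg Heq) as [n Hn].
apply (not_integer_between (x i - x (i + 1)%Z) (-1)) with n; [|assumption].
pose proof (wave_lift_step i). lra.
Qed.

Lemma wave_rotR i : rotR (z i) = z (2 * s - 1 - i)%Z.
Proof.
unfold z. assert (Hhalf : forall t, gamma (t + 1/2) = rotR (gamma t)) by apply Hg. rewrite <- Hhalf.
(* The integer [s - 1 - i] is the gap between [x (2 * s - 1 - i)] and [x i + 1/2]. *)
rewrite <- (curve_period gamma (x i + 1/2) (s - 1 - i)) by assumption. f_equal.
unfold x, wave_lift. replace (2 * s - 1 - i)%Z with (- 1 - i + 2 * s)%Z by ring.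
rewrite (wave_period _ _ _ _ HU), (bw_rev _ _ _ _ HU).
rewrite !plus_IZR, !minus_IZR, mult_IZR. field.
Qed.

Lemma wave_periodic : periodic z (2 * s).
Proof. intros i. unfold z. rewrite wave_in_X. now apply curve_period. Qed.

Lemma wave_minimal_period : minimal_period z (2 * s).
Proof.
pose proof (bw_m _ _ _ _ HU). split; [lia|]. split; [apply wave_periodic|].
intros q Hq Hper. apply (wave_no_period _ _ _ _ HU q Hq).
intros i. destruct (curve_eq_integer gamma _ _ Hg (Hper i)) as [n Hn].
unfold x, wave_lift in Hn. rewrite plus_IZR in Hn.
pose proof (bw_bound _ _ _ _ HU i). pose proof (bw_bound _ _ _ _ HU (i + q)%Z).
(* Two deviations differ by less than [1/2], which pins the integer down; then [q] is a period of
   [U] itself. *)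
assert (Hqn : (q = 2 * n)%Z).
{ assert (Hlt : IZR (2 * n) < IZR (q + 1)) by (rewrite plus_IZR, mult_IZR; lra).
  assert (Hgt : IZR (q - 1) < IZR (2 * n)) by (rewrite minus_IZR, mult_IZR; lra).
  apply lt_IZR in Hlt. apply lt_IZR in Hgt. lia. }
rewrite Hqn, mult_IZR in Hn. rewrite Hqn. lra.
Qed.

Lemma wave_rotation_number : has_rotation_number gamma z (1/2).
Proof.
exists x. split; [apply wave_is_lift|].
apply is_lim_seq_spec. intros eps. simpl.
(* The deviation [c + U] from the line of slope [1/2] stays below [Rabs c + 1] in absolute value. *)
destruct (nfloor_ex (Rmax 0 ((Rabs c + 1) / eps)) ltac:(apply Rmax_l)) as [N [_ HN]].
exists (N + 1)%nat. intros n Hn. apply le_INR in Hn. rewrite plus_INR in Hn. simpl in Hn.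
pose proof (cond_pos eps) as Heps. pose proof (pos_INR N).
assert (Hbig : Rabs c + 1 < INR n * eps).
{ assert (H1 : (Rabs c + 1) / eps < INR n).
  { eapply Rle_lt_trans; [apply (Rmax_r 0)|]. lra. }
  apply (Rmult_lt_compat_r eps) in H1; [|assumption].
  replace ((Rabs c + 1) / eps * eps) with (Rabs c + 1) in H1 by (field; lra). lra. }
unfold x, wave_lift. rewrite <- INR_IZR_INZ.
replace ((c + INR n / 2 + U (Z.of_nat n)) / INR n - 1 / 2) with ((c + U (Z.of_nat n)) / INR n) by (field; lra).
unfold Rdiv. rewrite Rabs_mult, (Rabs_pos_eq (/ INR n)) by (apply Rlt_le, Rinv_0_lt_compat; lra).
apply Rmult_lt_reg_r with (INR n); [lra|]. rewrite Rmult_assoc, Rinv_l by lra.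
pose proof (Rabs_triang c (U (Z.of_nat n))).
assert (Rabs (U (Z.of_nat n)) < 1) by (pose proof (bw_bound _ _ _ _ HU (Z.of_nat n)); apply Rabs_def1; lra).
lra.
Qed.

(** The difference of two lifts is an integer at each index, and it cannot jump because both lifts
    have increments in [(0, 1)]. *)
Lemma lift_unique (y : Z -> R) : is_lift gamma z y -> exists n : Z, forall i, y i = x i + IZR n.
Proof.
intros Hy.
assert (Hn : forall i, exists n : Z, y i - x i = IZR n).
{ intros i. apply (curve_eq_integer gamma); [exact Hg|]. apply Hy. }
assert (Hstep : forall i, y (i + 1)%Z - x (i + 1)%Z = y i - x i).
{ intros i. destruct (Hn i) as [n1 H1]. destruct (Hn (i + 1)%Z) as [n2 H2].
  pose proof (proj2 (Hy i)). pose proof (wave_lift_step i).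
  assert (H3 : IZR n1 < IZR (n2 + 1)) by (rewrite plus_IZR; lra).
  assert (H4 : IZR n2 < IZR (n1 + 1)) by (rewrite plus_IZR; lra).
  apply lt_IZR in H3. apply lt_IZR in H4. rewrite H1, H2. f_equal. lia. }
destruct (Hn 0%Z) as [n H0]. exists n.
apply (Z_shift_ind 1 (fun i => y i = x i + IZR n)); [lia| | |].
- intros j Hj. specialize (Hstep j). lra.
- intros j Hj. specialize (Hstep j). lra.
- intros r Hr. replace r with 0%Z by lia. lra.
Qed.

(* A Birkhoff lift would compare [x] with its translate [x (. + 2) - 1] uniformly, making [U] monotone along steps of 2. *)
Lemma wave_not_birkhoff : ~ birkhoff gamma z.
Proof.
intros [y [Hy Hb]]. destruct (lift_unique y Hy) as [n Hn].
assert (Hx : forall i, y i = c + IZR i / 2 + U i + IZR n) by (intros; apply Hn).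
destruct (Rle_dec (U 2%Z) (U 0%Z)) as [H|H].
- apply (wave_not_monotone D s m U HU U); [|left; reflexivity].
  intros j. specialize (Hb 2%Z 0%Z 1%Z j). rewrite !Hx in Hb. specialize (Hb ltac:(lra)).
  rewrite !plus_IZR in Hb. replace (2 + j)%Z with (j + 2)%Z in Hb by ring.
  replace (0 + j)%Z with j in Hb by ring. lra.
- apply (wave_not_monotone D s m U HU (fun j => - U j)); [|right; reflexivity].
  intros j. specialize (Hb 0%Z 2%Z (-1)%Z j). rewrite !Hx in Hb. specialize (Hb ltac:(lra)).
  rewrite !plus_IZR in Hb. replace (2 + j)%Z with (j + 2)%Z in Hb by ring.
  replace (0 + j)%Z with j in Hb by ring. lra.
Qed.

(** Two different reversals realising the same half turn compose to a shift shorter than the minimal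
    period. *)
Lemma wave_rotR_index_unique (k : Z) :
  (0 < k < 2 * s)%Z -> (forall i, rotR (z i) = z (k - i)%Z) -> k = (2 * s - 1)%Z.
Proof.
intros Hk HR. destruct (Z.eq_dec k (2 * s - 1)) as [|Hne]; [assumption|exfalso].
apply (proj2 (proj2 wave_minimal_period) (2 * s - 1 - k)%Z); [lia|].
intros j. pose proof (HR (k - j)%Z) as H. rewrite wave_rotR in H.
replace (2 * s - 1 - (k - j))%Z with (j + (2 * s - 1 - k))%Z in H by ring.
replace (k - (k - j))%Z with j in H by ring. exact H.
Qed.

(** Shifting by [s] negates [U], which mirrors the point in the axis, and adds half turns of total
    sign [zsign s]; thus [S] and the parity of [s] decide between the alternatives. *)
Lemma wave_axis_symmetry :
  axis_reflection S -> (forall t, gamma (c - t) = S (gamma (c + t))) ->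
  (forall i, reflS (z i) = z (s + i)%Z) \/ (forall i, rotRS (z i) = z (s + i)%Z).
Proof.
intros HS Hsym.
assert (Hz : forall i, z (s + i)%Z = (zsign s * fst (S (z i)), zsign s * snd (S (z i)))).
{ intros i. unfold z at 1. unfold x, wave_lift. rewrite (Z.add_comm s i), (bw_shift _ _ _ _ HU).
  replace (c + IZR (i + s) / 2 + - U i) with (c - (IZR i / 2 + U i) + IZR (2 * i + s) / 2)
    by (rewrite !plus_IZR, mult_IZR; field).
  rewrite curve_half_turn by assumption.
  replace (zsign (2 * i + s)) with (zsign s) by (unfold zsign; rewrite Z.even_add, Z.even_mul; simpl; now destruct (Z.even s)).
  rewrite Hsym. unfold z, x, wave_lift. now rewrite Rplus_assoc. }
unfold zsign in Hz.
destruct HS as [HS|HS], (Z.even s); [left|right|right|left]; intros i; rewrite Hz, HS;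
  unfold rotRS, rotR, reflS; simpl; f_equal; ring.
Qed.

Lemma wave_D2_symmetric :
  axis_reflection S -> (forall t, gamma (c - t) = S (gamma (c + t))) -> D2_symmetric z.
Proof.
intros HS Hsym.
assert (Hinv : forall a, rotR (rotR a) = a).
{ intros [a b]. unfold rotR; simpl. f_equal; ring. }
split; [|split].
- exists 0%Z. left. reflexivity.
- exists (2 * s - 1)%Z. right. apply wave_rotR.
- destruct (wave_axis_symmetry HS Hsym) as [H|H]; split.
  + exists s. now left.
  + exists (s - 1)%Z. right. intros i. unfold rotRS. rewrite H, wave_rotR. f_equal. ring.
  + exists (s - 1)%Z. right. intros i. rewrite <- (Hinv (reflS (z i))). change (rotR (reflS (z i))) with (rotRS (z i)).
    rewrite H, wave_rotR. f_equal. ring.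
  + exists s. now left.
Qed.

End Orbit.

(** * Existence of the type II orbit *)

Theorem mainTheorem2 :
  forall (gamma : R -> pt) (Zo : Z -> pt) (s : Z),
    billiard_curve gamma ->
    billiard_orbit gamma Zo ->
    periodic Zo 2%Z ->
    D2_symmetric Zo ->
    birkhoff gamma Zo ->
    (2 <= s)%Z ->
    (forall t, gamma t = Zo 0%Z ->
       curvature gamma t * vnorm (vsub (Zo 1%Z) (Zo 0%Z))
       < 2 * (cos (PI / IZR (2 * s))) ^ 2) ->
    exists z : Z -> pt,
      billiard_orbit gamma z /\
      D2_symmetric z /\
      ~ birkhoff gamma z /\
      minimal_period z (2 * s)%Z /\
      has_rotation_number gamma z (1/2) /\
      (exists k : Z, Z.odd k = true /\ (0 < k < 2 * s)%Z /\
         (forall i, rotR (z i) = z (k - i)%Z) /\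
         (forall k', (0 < k' < 2 * s)%Z ->
            (forall i, rotR (z i) = z (k' - i)%Z) -> k' = k)) /\
      ((forall i, reflS (z i) = z (s + i)%Z) \/
       (forall i, rotRS (z i) = z (s + i)%Z)) /\
      (exists x X : Z -> R,
         is_lift gamma z x /\ is_lift gamma Zo X /\
         in_X (2 * s) s x /\ in_X (2 * s) s X /\
         num_sign_changes_eq (fun i => x i - X i) (2 * s) 2).
Proof.
intros gamma Zo s Hg [[Hon _] _] Hper HD2 _ Hs Hcurv.
destruct (Hon 0%Z) as [c Hc].
destruct (two_periodic_axis gamma Zo c Hg Hper HD2 Hc) as [HZ1 [S [HS Hsym]]].
specialize (Hcurv c Hc). rewrite HZ1, <- Hc in Hcurv.
destruct (curvature_condition gamma c _ S Hg HS Hsym Hcurv) as [Hd2 Hcond].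
destruct (exists_balanced_wave _ _ _ _ _ s (curve_frame gamma c S Hg HS Hsym) Hs Hd2 Hcond)
  as [m [U HU]].
exists (fun i => gamma (wave_lift c U i)).
split; [split; [eapply wave_billiard_sequence; eassumption|]|].
{ intros i. apply wave_reflection_law; [assumption|]. apply (bw_eq _ _ _ _ HU). }
split; [eapply wave_D2_symmetric; eassumption|].
split; [eapply wave_not_birkhoff; eassumption|].
split; [eapply wave_minimal_period; eassumption|].
split; [eapply wave_rotation_number; eassumption|].
split.
{ exists (2 * s - 1)%Z. split; [now rewrite Z.odd_sub, Z.odd_mul|]. split; [lia|].
  split; [eapply wave_rotR; eassumption|]. intros k Hk HR. eapply wave_rotR_index_unique; eassumption. }
split; [eapply wave_axis_symmetry; eassumption|].
(* With this lift of [Zo], the difference of the lifts is exactly [U]. *)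
exists (wave_lift c U), (fun i => c + IZR i / 2).
split; [eapply wave_is_lift; eassumption|].
split.
{ intros i. split; [|rewrite plus_IZR; lra].
  rewrite curve_half_turn, (periodic_2_value Zo i Hper), HZ1, <- Hc by assumption. unfold zsign.
  destruct (Z.even i); [rewrite (surjective_pairing (gamma c)) at 3|unfold rotR]; f_equal; ring. }
split; [eapply wave_in_X; eassumption|].
split; [intros i; rewrite plus_IZR, mult_IZR; field|].
replace (fun i => wave_lift c U i - (c + IZR i / 2)) with U.
- eapply wave_sign_changes; eassumption.
- apply functional_extensionality. intros i. unfold wave_lift. ring.
Qed.
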